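(* For every integer $n\ge 0$ and every $x\in\mathbb R$, let $RW_n=(0,M_1^x,\dots,M_n^x)$ be the explicit random walk described in the context, and let $RW_{n,x}=(0,M^x_{1,x},\dots,M^x_{n,x})$ be its version stopped at level $x$. Then $RW_n$ stopped at $x$ maximizes the probability of visiting $[x,\infty)$ within the first $n$ steps among all martingale random walks of class $\mathcal M$, that is, $$D_n(x)=\mathbb P\{RW_{n,x}\text{ visits the interval }[x,\infty)\}=\mathbb P\{M^x_{n,x}\ge x\}.$$
   Context: A random walk of length $n$ is $W_n=(M_0,M_1,\dots,M_n)$ with $M_0=0$, $M_k=X_1+\dots+X_k$. We write $W_n\in\mathcal M$ if, on some probability space, $(M_k)_{0\le k\le n}$ is a martingale with respect to some increasing sequence of $\sigma$-algebras $\mathcal F_0\subset\dots\subset\mathcal F_n$, i.e. $\mathbf E(X_m\mid\mathcal F_{m-1})=0$, and $|X_m|\le 1$ for all $m$. The walk visits $[x,\infty)$ if $M_k\ge x$ for some $0\le k\le n$. For $x\in\mathbb R$, $$D_n(x)=\sup_{W_n\in\mathcal M}\mathbb P\{W_n\text{ visits }[x,\infty)\}.$$ Stopping at level $x$: $\tau_x=\min\{k: M_k\ge x\}$ (with value $+\infty$ if there is no such $k$), $M_{k,x}=M_{\tau_x\wedge k}$, and $W_{n,x}=(0,M_{1,x},\dots,M_{n,x})$. The walk $RW_n$ (for given $n$ and $x$): it starts at $0$ and is a time-inhomogeneous Markov chain. Suppose that after $k<n$ steps the remaining distance to the target is $\rho=\rho_k=x-M_k^x$. Since only the stopped walk matters,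 only the case $\rho>0$ needs to be specified (if $x\le 0$ the walk is stopped at time $0$). Let $\lfloor\rho\rfloor$ be the integer part and $\{\rho\}=\rho-\lfloor\rho\rfloor$ the fractional part of $\rho$. Given the past, the next step is a two-valued mean-zero random variable: the walk moves towards the target by $s_l$ (so $\rho_{k+1}=\rho-s_l$) with probability $p=\frac{s_r}{s_l+s_r}$, and away from the target by $s_r$ (so $\rho_{k+1}=\rho+s_r$) with probability $q=\frac{s_l}{s_l+s_r}$, where: (i) if $\rho$ is an integer: $s_l=s_r=1$, $p=q=\tfrac12$; (ii) if $n-k-1$ is odd and $0<\rho<1$: $s_l=\rho$, $s_r=1-\rho$, $p=1-\{\rho\}$, $q=\{\rho\}$; (iii) if $\rho$ is not an integer and $\lfloor\rho\rfloor+n-k-1$ is even: $s_l=\{\rho\}$, $s_r=1$, $p=\frac1{1+\{\rho\}}$, $q=\frac{\{\rho\}}{1+\{\rho\}}$; (iv) if $\rho$ is not an integer, $\rho>1$, and $\lfloor\rho\rfloor+n-k-1$ is odd: $s_l=1$, $s_r=1-\{\rho\}$, $p=\frac{1-\{\rho\}}{2-\{\rho\}}$, $q=\frac1{2-\{\rho\}}$. *)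

(* Defs.v *)
From HB Require Import structures.
From mathcomp Require Import all_boot all_order all_algebra.
From mathcomp Require Import all_classical all_reals all_analysis.

Set Implicit Arguments.
Unset Strict Implicit.
Unset Printing Implicit Defensive.

Import Order.TTheory GRing.Theory Num.Theory.
Import numFieldNormedType.Exports.

Local Open Scope classical_set_scope.
Local Open Scope ring_scope.

(* A walk of length n is given by its positions W : nat -> T -> R; only
   W 0, ..., W n are ever used. *)

Definition step (T : Type) (R : realType) (W : nat -> T -> R) (m : nat)
  : T -> R := fun w => W m.+1 w - W m w.

Definition visits (T : Type) (R : realType) (n : nat) (W : nat -> T -> R)
    (x : R) : set T :=
  [set w | exists k, (k <= n)%N /\ x <= W k w].

(* The value n.+1, larger than all times of the walk, plays the role of +oo. *)
Definition hitting_time (T : Type) (R : realType) (n : nat) (W : nat -> T -> R)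
    (x : R) (w : T) : nat :=
  find (fun k => x <= W k w) (iota 0 n.+1).

Definition stopped (T : Type) (R : realType) (n : nat) (W : nat -> T -> R)
    (x : R) : nat -> T -> R :=
  fun k w => W (minn (hitting_time n W x w) k) w.

Definition measurable_wrt (T : Type) (R : realType) (G : set (set T))
    (Y : T -> R) : Prop :=
  preimage_set_system setT Y measurable `<=` G.

(* Y is a version of the conditional expectation E(X | G). *)
Definition is_cond_expectation d (T : measurableType d) (R : realType)
    (P : probability T R) (G : set (set T)) (X Y : T -> R) : Prop :=
  [/\ P.-integrable setT (EFin \o X),
      measurable_wrt G Y,
      P.-integrable setT (EFin \o Y) &
      forall A, G A ->
        (\int[P]_(w in A) (Y w)%:E = \int[P]_(w in A) (X w)%:E)%E].

Definition is_filtration d (T : measurableType d) (n : nat)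
    (F : nat -> set (set T)) : Prop :=
  [/\ forall k, (k <= n)%N -> sigma_algebra setT (F k),
      forall k, (k <= n)%N -> F k `<=` measurable &
      forall k, (k < n)%N -> F k `<=` F k.+1].

(* Membership in the class depends only on the law of the walk, so the bound
   on the steps is required almost surely. *)
Definition martingale_walk d (T : measurableType d) (R : realType)
    (P : probability T R) (n : nat) (W : nat -> T -> R) : Prop :=
  (forall w, W 0%N w = 0) /\
  exists F : nat -> set (set T),
    [/\ is_filtration n F,
        forall k, (k <= n)%N -> measurable_wrt (F k) (W k),
        forall m, (m < n)%N ->
          is_cond_expectation P (F m) (step W m) (cst 0) &
        forall m, (m < n)%N -> {ae P, forall w, `|step W m w| <= 1}].

Definition D (R : realType) (n : nat) (x : R) : \bar R :=
  ereal_sup [set r | exists (d : measure_display) (T : measurableType d)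
                            (P : probability T R) (W : nat -> T -> R),
                       martingale_walk P n W /\ r = P (visits n W x)].

Definition frac_part (R : realType) (r : R) : R := r - (Num.floor r)%:~R.

(* The pair (s_l, s_r) of step sizes towards and away from the target, after k
   steps out of n and at remaining distance rho > 0. The four branches are the
   cases (rho integer), (n-k-1 odd and 0 < rho < 1), (floor rho + n-k-1 even),
   (floor rho + n-k-1 odd and rho > 1); for rho > 0, floor rho is nonnegative,
   so taking its absolute value only casts it to nat. *)
Definition RW_step_sizes (R : realType) (n k : nat) (rho : R) : R * R :=
  let f := frac_part rho in
  if rho \is a Num.int then (1, 1)
  else if odd (n - k - 1) && (0 < rho < 1) then (rho, 1 - rho)
  else if ~~ odd (absz (Num.floor rho) + (n - k - 1)) then (f, 1)
  else (1, 1 - f).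

(* W is a realization of the Markov chain RW_n on (T, P): for every history
   a 0, ..., a k of the walk at positive remaining distance from the target,
   the next step given that history has the prescribed two-point law. Nothing
   is prescribed for the steps made from positions at or beyond the target. *)
Definition is_RW d (T : measurableType d) (R : realType)
    (P : probability T R) (n : nat) (x : R) (W : nat -> T -> R) : Prop :=
  [/\ forall w, W 0%N w = 0,
      forall k, (k <= n)%N -> measurable_fun setT (W k) &
      forall (k : nat) (a : nat -> R), (k < n)%N -> a k < x ->
        let: (sl, sr) := RW_step_sizes n k (x - a k) in
        let p := sr / (sl + sr) in
        let q := sl / (sl + sr) in
        let past := [set w | forall i, (i <= k)%N -> W i w = a i] in
        (P (past `&` [set w | W k.+1 w = (a k + sl)%R]) = p%:E * P past)%E /\
        (P (past `&` [set w | W k.+1 w = (a k - sr)%R]) = q%:E * P past)%E].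

(* Main.v *)
Require Import Defs.
From HB Require Import structures.
From mathcomp Require Import all_boot all_order all_algebra.
From mathcomp Require Import all_classical all_reals all_analysis.
From mathcomp Require Import measurable_realfun ring lra.

Set Implicit Arguments.
Unset Strict Implicit.
Unset Printing Implicit Defensive.

Import Order.TTheory GRing.Theory Num.Theory.
Import numFieldNormedType.Exports.

Local Open Scope classical_set_scope.
Local Open Scope ring_scope.

(** Let [win m rho] be the success probability of the walk RW from distance
    [rho] with [m] steps left. At every [rho > 0] the two points that RW can
    reach in one step span a chord of [win m] whose value at [rho] is
    [win m.+1 rho] and which lies above [win m] on [rho - 1, rho + 1]: [win m]
    is convex between consecutive integers, and the remaining comparisons
    between neighbouring intervals go by induction on [m]. Hence, along any
    martingale with steps bounded by 1, replacing the future by RW defines a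
    supermartingale up to the hitting time, which bounds the visiting
    probability by [win n x]; along RW itself it is a martingale. *)

(** * The success probability of RW *)

(** The four cases of the step rule reflect a parity pattern. At a positive integer congruent mod 2
    to the number [m] of steps left, [win m] has a concave kink: its value dominates the chords of
    length 2 in [win_chord_left] and [win_chord_right]. Across an integer of the opposite parity it
    bends convexly; the extra value of [convex_ext], one unit outside the interval, records this.
    The point 0 also acts as a kink, since [win m] is 1 there and at most 1 elsewhere. So the best
    chord above a non-integer distance rests on a neighbouring integer of the parity of [m], or on
    0, and reaches as far as a unit step allows on the other side; if [m] is odd and [0 < rho < 1],
    both neighbours are supports and it joins them. Which neighbour is the kink depends on the
    parity of the interval, and this is why convexity is proved in two mirror forms.

    On the probabilistic side, [is_RW] constrains only exact histories, each of which could be null.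
    The transfer to almost sure statements rests on the walk having only countably many possible
    histories before it reaches the target. *)

Section win.
Variable R : realType.
Implicit Types (m j k : nat) (rho f t : R).

Notation sizes m rho := (RW_step_sizes m.+1 0 rho).

(** Only the number of steps left after the current one matters; it is the index [m] of the notation
    [sizes m]. *)
Lemma RW_step_sizesE n k rho :
  (k < n)%N -> RW_step_sizes n k rho = sizes (n - k.+1)%N rho.
Proof.
by move=> kn; rewrite /RW_step_sizes subn0 subSS subn0 -subnDA addn1.
Qed.

Lemma floor_natD j f : 0 <= f < 1 -> Num.floor (j%:R + f) = j%:Z.
Proof.
move=> /andP[f0 f1]; apply/floor_def; rewrite rmorphD /= -pmulrn lerDl f0 /=.
by rewrite ltrD2l.
Qed.

Lemma frac_part_natD j f : 0 <= f < 1 -> frac_part (j%:R + f) = f.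
Proof.
by move=> f01; rewrite /frac_part floor_natD// -pmulrn addrC addKr.
Qed.

Lemma natD_notint j f : 0 < f < 1 -> (j%:R + f \is a Num.int) = false.
Proof.
move=> f01; have f01' : 0 <= f < 1 by lra.
apply/negbTE; rewrite intrEfloor floor_natD// -pmulrn; apply/eqP => E; lra.
Qed.

Lemma sizes_nat m j : sizes m j%:R = (1, 1) :> R * R.
Proof. by rewrite /RW_step_sizes natr_int. Qed.

Lemma sizes_lt1 m f : 0 < f < 1 -> odd m -> sizes m f = (f, 1 - f).
Proof.
move=> f01 om; have := natD_notint 0 f01; rewrite add0r => fi.
by rewrite /RW_step_sizes fi subn0 subn1 /= om f01.
Qed.

Lemma sizes_even m j f :
  0 < f < 1 -> ~~ odd (j + m) -> sizes m (j%:R + f) = (f, 1).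
Proof.
move=> f01 ojm; have f01' : 0 <= f < 1 by lra.
rewrite /RW_step_sizes natD_notint// subn0 subn1 /= floor_natD// frac_part_natD//.
rewrite absz_nat ojm; case: ifPn => // /andP[om /andP[_ lt1]].
case: j ojm lt1 => [|j]; first by rewrite om.
by move=> _ lt1; exfalso; have := ler0n R j; rewrite -natr1 in lt1; lra.
Qed.

Lemma sizes_odd m j f : 0 < f < 1 -> (0 < j)%N -> odd (j + m) ->
  sizes m (j%:R + f) = (1, 1 - f).
Proof.
move=> f01 j0 ojm; have f01' : 0 <= f < 1 by lra.
rewrite /RW_step_sizes natD_notint// subn0 subn1 /= floor_natD// frac_part_natD//.
rewrite absz_nat ojm; case: ifPn => // /andP[om /andP[_ lt1]].
case: j j0 {ojm} lt1 => // j _ lt1; exfalso.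
by have := ler0n R j; rewrite -natr1 in lt1; lra.
Qed.

Lemma natD_fracE rho : 0 < rho ->
  exists j f, [/\ rho = j%:R + f, 0 <= f & f < 1].
Proof.
move=> r0; exists `|Num.floor rho|%N, (rho - (Num.floor rho)%:~R).
have fl : 0 <= Num.floor rho by rewrite floor_ge0 ltW.
have := floorD1_gt rho; have := floor_le_tmp rho; rewrite rmorphD /= => h1 h2.
rewrite pmulrn gez0_abs//; split; [ring|lra|].
by rewrite -pmulrn in h2; lra.
Qed.

(* The success probability of the walk started at distance rho from the target
   with m steps left. *)
Fixpoint win m rho : R :=
  if rho <= 0 then 1 else
  if m is m'.+1 then
    let: (sl, sr) := sizes m' rho in
    (sr * win m' (rho - sl) + sl * win m' (rho + sr)) / (sl + sr)
  else 0.

Lemma win_le0 m rho : rho <= 0 -> win m rho = 1.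
Proof. by case: m => [|m] /= ->. Qed.

Lemma win0_gt0 rho : 0 < rho -> win 0 rho = 0.
Proof. by move=> r0 /=; rewrite leNgt r0. Qed.

Lemma winS m rho : 0 < rho ->
  win m.+1 rho = ((sizes m rho).2 * win m (rho - (sizes m rho).1) +
    (sizes m rho).1 * win m (rho + (sizes m rho).2)) /
    ((sizes m rho).1 + (sizes m rho).2).
Proof. by move=> r0 /=; rewrite leNgt r0 /=; case: (RW_step_sizes _ _ _). Qed.

Lemma sizes_bounds m rho : 0 < rho ->
  [/\ 0 < (sizes m rho).1 <= 1, 0 <= (sizes m rho).2 <= 1 &
      1 <= (sizes m rho).1 + (sizes m rho).2].
Proof.
move=> r0; have [j [f [rE f0 f1]]] := natD_fracE r0.
have [fe|fn] := eqVneq f 0.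
  by rewrite rE fe addr0 sizes_nat /=; split; lra.
have f01 : 0 < f < 1 by rewrite lt_def fn f0 f1.
have [ojm|ejm] := boolP (odd (j + m)); last first.
  by rewrite rE sizes_even//=; split; lra.
case: j ojm rE => [om|j ojm] rE; last by rewrite rE sizes_odd//=; split; lra.
by rewrite rE add0r sizes_lt1//=; split; lra.
Qed.

Lemma win_bounds m rho : 0 <= win m rho <= 1.
Proof.
elim: m rho => [|m IH] rho.
  by rewrite /=; case: ifP => _; lra.
have [r0|r0] := leP rho 0; first by rewrite win_le0//; lra.
rewrite winS//; have [] := sizes_bounds m r0.
move: (RW_step_sizes _ _ _) => [sl sr] /= h1 h2 h3.
have := IH (rho - sl); have := IH (rho + sr); move: (win _ _) (win _ _) => a b.
move=> ha hb; apply/andP; split.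
  by rewrite divr_ge0//; nra.
by rewrite ler_pdivrMr; [nra|lra].
Qed.

(** * Integer distances: the simple random walk *)

Lemma win_nat0 m : win m 0%:R = 1. Proof. exact: win_le0. Qed.

Lemma win_natS m k :
  win m.+1 k.+1%:R = (win m k%:R + win m k.+2%:R) / 2.
Proof.
rewrite winS ?ltr0n// sizes_nat/= !mul1r -[k.+2%:R]natr1.
by rewrite -[in X in win _ X]natr1 addrK natr1.
Qed.

(** By [win_natS] the second difference is twice the gain from one more step, so this convexity is
    what makes [win] grow with [m] at integers. *)
Lemma win_nat_convex m k :
  2 * win m k.+1%:R <= win m k%:R + win m k.+2%:R.
Proof.
elim: m k => [|m IH] k.
  rewrite (win0_gt0 (ltr0Sn _ k)) (win0_gt0 (ltr0Sn _ k.+1)) mulr0 addr0.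
  by have := win_bounds 0 k%:R; lra.
rewrite (win_natS m k.+1) win_natS; case: k => [|k].
  by rewrite !win_nat0; have := IH 1%N; lra.
by rewrite win_natS; have := IH k; have := IH k.+2; lra.
Qed.

(* Over the integers RW is the simple random walk, which from k is at 0 only at
   times of the parity of k: when m has that parity, one more step brings no
   gain. *)
Lemma win_nat_affine m k : odd k.+1 = odd m ->
  win m k%:R + win m k.+2%:R = 2 * win m k.+1%:R.
Proof.
elim: m k => [|m IH] k.
  case: k => [//|k] _; rewrite !win0_gt0 ?ltr0n//; lra.
case: k => [|k] e; rewrite (win_natS m) win_natS.
  have := IH 1%N; rewrite !win_nat0 -[odd 2]negbK -[~~ odd 2]/(odd 1) e /= negbK.
  by move=> /(_ erefl) ->; field.
have e2 : odd k.+1 = odd m by move: e => /=; case: (odd k) (odd m) => -[].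
have e3 : odd k.+3 = odd m by rewrite -e2 /= negbK.
by rewrite win_natS; have := IH k e2; have := IH k.+2 e3; lra.
Qed.

Lemma win_nat_mono m k : win m k%:R <= win m.+1 k%:R.
Proof.
case: k => [|k]; first by rewrite !win_nat0.
by rewrite win_natS; have := win_nat_convex m k; lra.
Qed.

Lemma win_nat_stable m k : odd k = odd m -> win m.+1 k%:R = win m k%:R.
Proof.
case: k => [|k] e; first by rewrite !win_nat0.
by rewrite win_natS; have := win_nat_affine e; lra.
Qed.

(** The rule at integers differs from the one inside the interval, but both endpoints obey the same
    formula: at [j] an extra step brings no gain, at [j.+1] the simple walk averages its neighbours.
    The closed interval thus has the form treated by [convex_ext_transform]. *)
Lemma winS_even m j f : ~~ odd (j + m) -> 0 <= f <= 1 ->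
  win m.+1 (j%:R + f) * (1 + f) = win m j%:R + f * win m (j.+1%:R + f).
Proof.
move=> ejm f01; have e : odd j = odd m.
  by move: ejm; rewrite oddD; case: (odd j) (odd m) => -[].
have [->|fn0] := eqVneq f 0.
  by rewrite !addr0 mul0r mulr1 addr0 win_nat_stable.
have [->|fn1] := eqVneq f 1; first by rewrite !natr1 win_natS; field.
have f01' : 0 < f < 1.
  by rewrite lt_def lt_neqAle fn0 fn1.
have ? := ler0n R j.
rewrite winS; last lra.
rewrite sizes_even//= addrK -natr1 mul1r addrAC; field; lra.
Qed.

(** Measuring [t] downwards from the upper endpoint gives the recursion the shape of [winS_even],
    with the two directions exchanged. *)
Lemma winS_odd m j t : odd (j.+1 + m) -> 0 <= t <= 1 ->
  win m.+1 (j.+2%:R - t) * (1 + t) =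
    t * win m (j.+1%:R - t) + win m j.+2%:R.
Proof.
move=> ojm t01; have e : odd j.+2 = odd m.
  by move: ojm; rewrite oddD /=; case: (odd j) (odd m) => -[].
have [->|tn0] := eqVneq t 0.
  by rewrite !subr0 addr0 mul0r mulr1 add0r win_nat_stable.
have [->|tn1] := eqVneq t 1.
  by rewrite -![_.+1%:R]natr1 !addrK natr1 win_natS -natr1 natr1; field.
have t01' : 0 < t < 1.
  by rewrite lt_def lt_neqAle tn0 tn1.
have ? := ler0n R j.
have -> : j.+2%:R - t = j.+1%:R + (1 - t) by rewrite -[j.+2%:R]natr1; ring.
have h : 0 < 1 - t < 1 by lra.
rewrite winS; last by rewrite -natr1; lra.
rewrite sizes_odd//= mul1r.
have -> : j.+1%:R + (1 - t) - 1 = j.+1%:R - t by ring.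
have -> : j.+1%:R + (1 - t) + (1 - (1 - t)) = j.+2%:R.
  by rewrite -[j.+2%:R]natr1; ring.
field; lra.
Qed.

(** Both landing points are the integers 0 and 1, so [win m.+1] is affine here. *)
Lemma winS_lt1 m t : odd m -> 0 <= t <= 1 ->
  win m.+1 (1 - t) = t + (1 - t) * win m 1.
Proof.
move=> om t01.
have [->|tn0] := eqVneq t 0.
  by rewrite subr0 add0r mul1r -[1]/(1%:R : R) win_nat_stable.
have [->|tn1] := eqVneq t 1; first by rewrite subrr mul0r addr0 win_le0.
have t0 : 0 < t by rewrite lt_def tn0; case/andP: t01.
have t1 : t < 1 by rewrite lt_neqAle tn1; case/andP: t01.
have t01' : 0 < 1 - t < 1 by lra.
rewrite winS; last lra.
rewrite sizes_lt1//= subrr win_le0//.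
have -> : 1 - t + (1 - (1 - t)) = 1 by ring.
by field.
Qed.

End win.
Arguments win : simpl never.

(** * Convexity between integers *)

Section win_convexity.
Variable R : realType.
Implicit Types (m i j k : nat) (g : R -> R) (b c f t a : R).

(* g is convex on [0, 1], and stays so when extended by the value b at -1;
   there need not be a supporting line at 1, where win 0 jumps. *)
Definition convex_ext g b := forall t0, 0 <= t0 < 1 -> exists s,
  (forall t, 0 <= t <= 1 -> g t0 + s * (t - t0) <= g t) /\
  g t0 - s * (1 + t0) <= b.

Lemma eq_convex_ext g h b : (forall t, 0 <= t <= 1 -> g t = h t) ->
  convex_ext g b -> convex_ext h b.
Proof.
move=> gh gb t0 t01; have [s [h1 h2]] := gb _ t01; exists s.
have e0 : g t0 = h t0 by apply: gh; lra.
by rewrite -e0; split=> // t t1; rewrite -gh//; apply: h1.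
Qed.

(** The transform is the height at [t - 1] of the chord from [(-1, b)] to [(t, g t)], which is how
    one step of RW acts. Replacing [g] by a supporting line turns it into an affine function plus a
    nonnegative multiple of [1 / (1 + t)], hence into a convex minorant. *)
Lemma convex_ext_transform g b c : convex_ext g b -> 2 * b - g 0 <= c ->
  convex_ext (fun t => (b + t * g t) / (1 + t)) c.
Proof.
move=> gb gc t0 t01.
have [s [hs hsb]] := gb _ t01.
have [s0 [hs0 hs0b]] : exists s, (forall t, 0 <= t <= 1 ->
    g 0 + s * (t - 0) <= g t) /\ g 0 - s * (1 + 0) <= b.
  by apply: gb; rewrite lexx ltr01.
have t0p : 0 < 1 + t0 by lra.
(* [K] is the amount by which [b] exceeds the supporting line at -1, and the coefficient of
   [1 / (1 + t)]; [sg] is the derivative at [t0] of the resulting minorant. *)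
pose K := b - (g t0 - s * t0) + s.
have K0 : 0 <= K by rewrite /K; lra.
pose sg := s - K / (1 + t0) ^+ 2.
have tangent t : 0 <= t <= 1 ->
    (b + t0 * g t0) / (1 + t0) + sg * (t - t0) <= (b + t * g t) / (1 + t).
  move=> t1; have tp : 0 < 1 + t by lra.
  apply: (@le_trans _ _ ((b + t * (g t0 + s * (t - t0))) / (1 + t))); last first.
    rewrite ler_pM2r ?invr_gt0// lerD2l; apply: ler_wpM2l; first lra.
    exact: hs.
  rewrite -subr_ge0.
  have -> : (b + t * (g t0 + s * (t - t0))) / (1 + t) -
      ((b + t0 * g t0) / (1 + t0) + sg * (t - t0)) =
      K * (t - t0) ^+ 2 / ((1 + t) * (1 + t0) ^+ 2).
    by rewrite /sg /K; field; apply/andP; split; lra.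
  apply: divr_ge0; first by apply: mulr_ge0 => //; exact: sqr_ge0.
  by apply: mulr_ge0; [lra|exact: sqr_ge0].
exists sg; split=> //.
have := tangent 0; rewrite lexx ler01 => /(_ isT).
rewrite mul0r !addr0 divr1 sub0r mulrN => h0.
have [te|tn] := eqVneq t0 0.
  apply: le_trans gc; rewrite /sg /K te.
  by rewrite mul0r mulr0 !addr0 expr1n !divr1 subr0; lra.
have t0gt : 0 < t0 by rewrite lt_def tn; case/andP: t01.
(* The transform equals [b] at 0 and stays above the line of slope [g 0 - b] through that point.
   Hence [sg] is at least [g 0 - b], and the tangent at [t0] takes a value of at most [2 * b - g 0]
   at -1. *)
have h1 : b + t0 * (g 0 - b) <= (b + t0 * g t0) / (1 + t0).
  rewrite ler_pdivlMr//; have := hs0 t0; rewrite subr0 => /(_ _) hh.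
  have : g 0 + s0 * t0 <= g t0 by apply: hh; lra.
  by nra.
have h2 : g 0 - b <= sg by rewrite -(ler_pM2l t0gt); lra.
lra.
Qed.

Lemma convex_ext_chord g b t a c : convex_ext g b ->
  0 <= a -> a <= t -> t <= c -> c <= 1 ->
  (c - a) * g t <= (c - t) * g a + (t - a) * g c.
Proof.
move=> gb a0 at_ tc c1; have [t1|t1] := ltP t 1; last first.
  have -> : c = t by lra.
  by lra.
have [|s [h1 h2]] := gb t; first by lra.
have ha : g t + s * (a - t) <= g a by apply: h1; lra.
have hc : g t + s * (c - t) <= g c by apply: h1; lra.
nra.
Qed.

Lemma convex_ext_chordN1 g b t a : convex_ext g b ->
  0 <= t -> t <= a -> a <= 1 ->
  (1 + a) * g t <= (a - t) * b + (1 + t) * g a.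
Proof.
move=> gb t0 ta a1; have [t1|t1] := ltP t 1; last first.
  have -> : a = t by lra.
  by lra.
have [|s [h1 h2]] := gb t; first by lra.
have ha : g t + s * (a - t) <= g a by apply: h1; lra.
nra.
Qed.

(** The intervals whose lower end has parity opposite to [m] bend convexly at that end. For [i = 0]
    the true value 1 at distance -1 would be too small: [win 1 f] is [1 / (1 + f)], whose tangent at
    0 takes the value 2 there. *)
Lemma win_convex_odd m i : odd (i + m) ->
  convex_ext (fun f => win m (i%:R + f)) (if i is k.+1 then win m k%:R else 2).
Proof.
elim: m i => [|m IH] i.
  rewrite addn0; case: i => // i _ t0 t01; exists 0.
  have w0 t : 0 <= t -> win 0 (i.+1%:R + t) = 0 :> R.
    by move=> t1; rewrite win0_gt0// -natr1; have := ler0n R i; lra.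
  rewrite w0; last lra.
  split; last by have := win_bounds 0 (i%:R : R); lra.
  by move=> t t1; rewrite w0; lra.
rewrite addnS /= => oim.
have h1 : odd (i.+1 + m) by rewrite addSn.
have h := IH _ h1; apply: (@eq_convex_ext
    (fun f => (win m i%:R + f * win m (i.+1%:R + f)) / (1 + f))).
  move=> t t1; rewrite -winS_even// mulfK//.
  by apply/eqP => ?; lra.
apply: convex_ext_transform => //; rewrite addr0.
case: i oim {h1 h} => [|i] oim.
  by rewrite win_nat0; have := win_bounds m (1%:R : R); lra.
have oim' : odd i.+1 = odd m.
  by move: oim; rewrite oddD; case: (odd _) (odd m) => -[].
(* Affinity identifies [2 * b - g 0] with [win m i], the value one unit further left. *)
by have := win_nat_affine R oim'; have := win_nat_mono R m i; lra.
Qed.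

(** Mirror image of [win_convex_odd]: here the upper end has parity opposite to [m], so the interval
    is parametrized from that end and extended to the right. *)
Lemma win_convex_even m i : ~~ odd (i + m) ->
  convex_ext (fun t => win m (i.+1%:R - t)) (win m i.+2%:R).
Proof.
elim: m i => [|m IH] i.
  move=> _ t0 t01; exists 0; rewrite win0_gt0.
    split; last by have := win_bounds 0 (i.+2%:R : R); lra.
    by move=> t _; have := win_bounds 0 (i.+1%:R - t); lra.
  by rewrite -natr1; have := ler0n R i; lra.
rewrite addnS /= negbK; case: i => [om|i oim].
  have om' : odd 1 = odd m by rewrite /= -om.
  apply: (@eq_convex_ext (fun t => t + (1 - t) * win m 1)).
    by move=> t t1; rewrite winS_lt1.
  (* The function is affine and serves as its own supporting line; its value at -1 is
     [2 * win m 1 - 1], which is [win m 2] by affinity. *)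
  move=> t0 t01; exists (1 - win m 1); split; first by move=> t t1; lra.
  have := win_nat_affine R om'; have := win_nat_mono R m 2.
  by rewrite win_nat0; lra.
have h1 : ~~ odd (i + m) by move: oim; rewrite addSn.
have h := IH _ h1; apply: (@eq_convex_ext
    (fun t => (win m i.+2%:R + t * win m (i.+1%:R - t)) / (1 + t))).
  move=> t t1; rewrite addrC -winS_odd// mulfK//.
  by apply/eqP => ?; lra.
apply: convex_ext_transform => //; rewrite subr0.
have oim' : odd i.+2 = odd m.
  by move: oim; rewrite oddD /=; case: (odd _) (odd m) => -[].
by have := win_nat_affine R oim'; have := win_nat_mono R m i.+3; lra.
Qed.

(** Reduces the comparison of [win m] with a line to finitely many points: inside a unit interval
    the two ends suffice, whatever the parity. *)
Lemma win_below_chord m j (al be u v w : R) :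
  j%:R <= u -> u <= v -> v <= w -> w <= j.+1%:R ->
  win m u <= al + be * u -> win m w <= al + be * w ->
  win m v <= al + be * v.
Proof.
move=> ju uv vw wj hu hw; rewrite -natr1 in wj.
have [uw|uw] := leP w u; first by have -> : v = u by lra.
suff : (w - u) * win m v <= (w - v) * win m u + (v - u) * win m w.
  move=> h; rewrite -(@ler_pM2l _ (w - u)); last by lra.
  apply: (le_trans h); nra.
have [ojm|ejm] := boolP (odd (j + m)).
  have := @convex_ext_chord _ _ (v - j%:R) (u - j%:R) (w - j%:R)
    (win_convex_odd ojm).
  rewrite ![j%:R + _]addrC !subrK => h.
  by have {h} := h ltac:(lra) ltac:(lra) ltac:(lra) ltac:(lra); lra.
have := @convex_ext_chord _ _ (j.+1%:R - v) (j.+1%:R - w) (j.+1%:R - u)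
  (win_convex_even ejm).
rewrite !subKr -natr1 => h.
by have {h} := h ltac:(lra) ltac:(lra) ltac:(lra) ltac:(lra); lra.
Qed.

End win_convexity.

(** * The supporting chord *)

Section win_tangent.
Variable R : realType.
Implicit Types (m i j : nat) (rho f t y z al be : R).

Notation sizes m rho := (RW_step_sizes m.+1 0 rho).

(** The weights have barycentre [i.+1], so this is concavity across a kink. After multiplication by
    [1 + f], [winS_even] splits the left side into integer terms and [f] times the same expression
    for [m] and [i.+1]; the induction hypothesis then gives exactly the right side. *)
Lemma win_chord_left m i f : odd i.+1 = odd m -> 0 <= f <= 1 ->
  (1 + f) * win m (i%:R + f) + (1 - f) * win m (i.+2%:R + f) <=
  2 * win m i.+1%:R.
Proof.
move=> + f01; elim: m i => [|m IH] i.
  case: i => // i _; have i0 := ler0n R i.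
  by rewrite !win0_gt0 -?natr1; lra.
move=> e; have ev : ~~ odd (i + m).
  by move: e; rewrite oddD /=; case: (odd i) (odd m) => -[].
have ev2 : ~~ odd (i.+2 + m) by rewrite !addSn /= negbK.
have e2 : odd i.+2 = odd m.
  by move: e => /=; case: (odd i) (odd m) => -[].
have h1 := winS_even ev f01; have h2 := winS_even ev2 f01.
have h3 := IH _ e2; rewrite win_natS.
have : f * ((1 + f) * win m (i.+1%:R + f) + (1 - f) * win m (i.+3%:R + f)) <=
    f * (2 * win m i.+2%:R) by apply: ler_wpM2l => //; lra.
move=> h4; rewrite -(@ler_pM2l _ (1 + f)); last lra.
have -> : (1 + f) * ((1 + f) * win m.+1 (i%:R + f) +
    (1 - f) * win m.+1 (i.+2%:R + f)) =
    (1 + f) * (win m.+1 (i%:R + f) * (1 + f)) +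
    (1 - f) * (win m.+1 (i.+2%:R + f) * (1 + f)) by ring.
rewrite h1 h2; lra.
Qed.

(** Reflection of [win_chord_left] about the kink [i.+2]. With [winS_odd] the induction lowers [i]
    instead of raising it, so [i = 0] needs a separate argument. *)
Lemma win_chord_right m i t : odd i = odd m -> 0 <= t < 1 ->
  (1 - t) * win m (i.+1%:R - t) + (1 + t) * win m (i.+3%:R - t) <=
  2 * win m i.+2%:R.
Proof.
move=> + t01; elim: m i => [|m IH] i.
  move=> _; have i0 := ler0n R i.
  by rewrite !win0_gt0 -?[_.+3%:R]natr1 -?[_.+2%:R]natr1 -?[_.+1%:R]natr1; lra.
have t01' : 0 <= t <= 1 by lra.
(* For [i = 0] the lower point is in []0, 1]], where [winS_lt1] gives the value; convexity of
   [win m] on [[1, 2]] and its affinity at 1 replace the induction hypothesis. *)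
case: i => [om|i e].
  have om' : odd m by rewrite /= in om; rewrite -[odd m]negbK -om.
  have o1 : odd (1 + m).+1 by rewrite /= om'.
  have ev : ~~ odd (1 + m) by rewrite /= om'.
  rewrite winS_lt1// win_natS.
  have h := @winS_odd R m 1 t o1 t01'.
  have om2 : odd 1 = odd m by rewrite om'.
  have h2 := win_nat_affine R om2; rewrite win_nat0 in h2.
  have h3 := @convex_ext_chord _ _ _ t 0 1 (win_convex_even ev) (lexx _).
  have h4 := h3 ltac:(lra) ltac:(lra) ltac:(lra); rewrite !subr0 mul1r in h4.
  have e1 : 2%:R - 1 = 1 :> R by rewrite -natr1 addrK.
  rewrite e1 in h4.
  have h5 : t * win m (2%:R - t) <= t * ((1 - t) * win m 2%:R + t * win m 1).
    by apply: ler_wpM2l => //; lra.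
  rewrite mulrC [(1 + t) * _]mulrC h.
  rewrite [win m 2%:R](_ : _ = 2 * win m 1 - 1) in h5; last by lra.
  lra.
have e2 : odd i = odd m by move: e => /=; case: (odd i) (odd m) => -[].
have od : odd (i.+1 + m) by rewrite addSn /= oddD e2; case: (odd m).
have od2 : odd (i.+3 + m) by rewrite !addSn /= negbK oddD e2; case: (odd m).
have h1 := winS_odd od t01'; have h2 := winS_odd od2 t01'.
have h3 := IH _ e2; rewrite win_natS.
have : t * ((1 - t) * win m (i.+1%:R - t) + (1 + t) * win m (i.+3%:R - t)) <=
    t * (2 * win m i.+2%:R) by apply: ler_wpM2l => //; lra.
move=> h4; rewrite -(@ler_pM2l _ (1 + t)); last lra.
have -> : (1 + t) * ((1 - t) * win m.+1 (i.+2%:R - t) +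
    (1 + t) * win m.+1 (i.+4%:R - t)) =
    (1 - t) * (win m.+1 (i.+2%:R - t) * (1 + t)) +
    (1 + t) * (win m.+1 (i.+4%:R - t) * (1 + t)) by ring.
rewrite h1 h2; lra.
Qed.

(** The line is checked at the integers and at the extreme positions, then [win_below_chord] fills
    the gaps. An integer strictly between the chord's ends is handled by convexity across it. Beyond
    a positive kink on which the chord rests, the line meets [win m] at the kink and at one end of a
    chord from [win_chord_left] or [win_chord_right], so the other end of that chord lies below the
    line. *)
Lemma win_below_line m rho al be z : 0 < rho ->
  let u1 := rho - (sizes m rho).1 in let u2 := rho + (sizes m rho).2 in
  win m u1 = al + be * u1 -> win m u2 = al + be * u2 ->
  rho - 1 <= z <= rho + 1 -> win m z <= al + be * z.
Proof.
move=> r0.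
have [j [f [rE f0 f1]]] := natD_fracE r0.
(* Past the target [win] is constantly 1; a line equal to 1 at 0 and to a value of [win] at some
   [u > 0] cannot increase. *)
have neg u : 0 < u -> 1 = al -> win m u = al + be * u -> z <= 0 ->
    win m z <= al + be * z.
  move=> u0 al1 hu z0; rewrite win_le0//.
  have := win_bounds m u; rewrite hu => h.
  have : be <= 0 by rewrite -(pmulr_lle0 _ u0); lra.
  by move=> be0; rewrite -al1 lerDl mulr_le0.
have [fe|fn] := eqVneq f 0.
  rewrite rE fe addr0 sizes_nat /= natr1.
  case: j rE => [|j] rE; first by lra.
  rewrite -[j.+1%:R]natr1 addrK => h1 h2 z1.
  have h3 := win_nat_convex R m j.
  have h4 : win m j.+1%:R <= al + be * j.+1%:R.
    by rewrite -[j.+2%:R]natr1 -[j.+1%:R]natr1 in h2 h3 *; lra.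
  have [zj|zj] := leP z j.+1%:R.
    apply: (@win_below_chord _ m j al be j%:R z j.+1%:R) => //; lra.
  by apply: (@win_below_chord _ m j.+1 al be j.+1%:R z j.+2%:R) => //; lra.
have f01 : 0 < f < 1 by rewrite lt_def fn f0 f1.
have [ojm|ejm] := boolP (odd (j + m)); last first.
  rewrite rE sizes_even//= addrK => h1 h2 z1.
  have e2 : j%:R + f + 1 = j.+1%:R + f :> R by rewrite -natr1; ring.
  rewrite e2 in h2 z1.
  have h3 : win m j.+1%:R <= al + be * j.+1%:R.
    have od : odd (j.+1 + m) by rewrite addSn.
    have := @convex_ext_chordN1 _ _ _ 0 f (win_convex_odd od) (lexx _) f0 (ltW f1).
    rewrite addr0 h1 h2 -natr1 => h; rewrite -(@ler_pM2l _ (1 + f)); lra.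
  have [zj|zj] := leP z j%:R.
    case: j ejm h1 h2 h3 zj rE e2 z1 => [|i] ejm h1 h2 h3 zj rE e2 z1.
      apply: (neg _ _ _ h2) => //; first by rewrite -natr1; lra.
      by rewrite mulr0 addr0 win_nat0 in h1.
    have e : odd i.+1 = odd m.
      by move: ejm; rewrite oddD; case: (odd _) (odd m) => -[].
    have f01' : 0 <= f <= 1 by lra.
    have h4 := win_chord_left e f01'; rewrite h1 h2 in h4.
    have h5 : win m (i%:R + f) <= al + be * (i%:R + f).
      rewrite -(@ler_pM2l _ (1 + f)); last by lra.
      by move: h4; rewrite -[i.+2%:R]natr1 -[i.+1%:R]natr1; lra.
    apply: (@win_below_chord _ m i al be (i%:R + f) z i.+1%:R) => //; lra.
  have [zj1|zj1] := leP z j.+1%:R.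
    by apply: (@win_below_chord _ m j al be j%:R z j.+1%:R) => //; lra.
  apply: (@win_below_chord _ m j.+1 al be j.+1%:R z (j.+1%:R + f)) => //; lra.
case: j ojm rE => [om|i ojm] rE.
  rewrite rE add0r sizes_lt1//= subrr.
  have -> : f + (1 - f) = 1 by ring.
  rewrite win_le0// mulr0 addr0 mulr1 => h1 h2 z1.
  have [z0|z0] := leP z 0; first by apply: (neg 1) => //; rewrite mulr1.
  have [zj|zj] := leP z 1.
    have h0 : win m 0 = 1 :> R by rewrite win_le0.
    by apply: (@win_below_chord _ m 0 al be 0 z 1) => //; lra.
  (* Affinity at 1 puts the point of [win m] at 2 on the line as well, which settles [z > 1]. *)
  have om' : odd 1 = odd m by rewrite [odd m]om.
  have := win_nat_affine R om'; rewrite win_nat0 => h3.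
  by apply: (@win_below_chord _ m 1 al be 1 z 2) => //; lra.
rewrite rE sizes_odd//= => h1 h2 z1.
pose t := 1 - f.
have e1 : i.+1%:R + f - 1 = i.+1%:R - t by rewrite /t; ring.
have e2 : i.+1%:R + f + (1 - f) = i.+2%:R by rewrite -[i.+2%:R]natr1; ring.
rewrite e1 e2 in h1 h2 z1.
have ti : i%:R <= i.+1%:R - t by rewrite /t -natr1; lra.
have ev : ~~ odd (i + m) by move: ojm; rewrite addSn.
have h3 : win m i.+1%:R <= al + be * i.+1%:R.
  have := @convex_ext_chordN1 _ _ _ 0 t (win_convex_even ev) (lexx _).
  rewrite subr0 h1 h2 -[i.+2%:R]natr1 /t => /(_ ltac:(lra) ltac:(lra)) h.
  rewrite -(@ler_pM2l _ (1 + t)); rewrite /t; lra.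
have [zj|zj] := leP z i.+1%:R.
  by apply: (@win_below_chord _ m i al be (i.+1%:R - t) z i.+1%:R) => //; lra.
have [zj1|zj1] := leP z i.+2%:R.
  by apply: (@win_below_chord _ m i.+1 al be i.+1%:R z i.+2%:R) => //; lra.
have e : odd i = odd m.
  by move: ev; rewrite oddD; case: (odd _) (odd m) => -[].
have t01 : 0 <= t < 1 by rewrite /t; lra.
have := win_chord_right e t01; rewrite h1 h2 => h4.
have h5 : win m (i.+3%:R - t) <= al + be * (i.+3%:R - t).
  rewrite -(@ler_pM2l _ (1 + t)); last by lra.
  by move: h4; rewrite -[i.+3%:R]natr1 -[i.+2%:R]natr1; lra.
apply: (@win_below_chord _ m i.+2 al be i.+2%:R z (i.+3%:R - t)) => //;
  rewrite /t; lra.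
Qed.

(** The slope with respect to progress towards the target, hence the opposite of the slope in
    [rho]. *)
Definition win_slope m rho :=
  (win m (rho - (sizes m rho).1) - win m (rho + (sizes m rho).2)) /
  ((sizes m rho).1 + (sizes m rho).2).

Lemma win_slope_le1 m rho : 0 < rho -> `|win_slope m rho| <= 1.
Proof.
move=> r0; have [h1 h2 h3] := sizes_bounds m r0; rewrite /win_slope.
have := win_bounds m (rho - (sizes m rho).1).
have := win_bounds m (rho + (sizes m rho).2).
move: (win _ _) (win _ _) => a b ha hb.
rewrite normrM normfV [`|_.1 + _|]ger0_norm; last lra.
rewrite ler_pdivrMr; last lra.
by rewrite mul1r ler_norml; lra.
Qed.

(** Pointwise form of the supermartingale inequality: the correction is linear in the step [y], so
    it averages out for a martingale difference. *)
Lemma win_tangent m rho y : 0 < rho -> `|y| <= 1 ->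
  win m (rho - y) <= win m.+1 rho + win_slope m rho * y.
Proof.
move=> r0; rewrite ler_norml => y1.
have [h1 h2 h3] := sizes_bounds m r0.
have h := @win_below_line m rho (win m.+1 rho + win_slope m rho * rho)
  (- win_slope m rho) (rho - y) r0.
have -> : win m.+1 rho + win_slope m rho * y =
  win m.+1 rho + win_slope m rho * rho + - win_slope m rho * (rho - y) by ring.
apply: h; last by lra.
  by rewrite winS// /win_slope; field; apply/eqP => ?; lra.
by rewrite winS// /win_slope; field; apply/eqP => ?; lra.
Qed.

Lemma win_tangent_step m rho y : 0 < rho ->
  y = (sizes m rho).1 \/ y = - (sizes m rho).2 ->
  win m (rho - y) = win m.+1 rho + win_slope m rho * y.
Proof.
move=> r0; have [h1 h2 h3] := sizes_bounds m r0.
move=> [|] ->; rewrite ?opprK winS// /win_slope; field; apply/eqP => ?; lra.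
Qed.

End win_tangent.

(** * Measurability and integration *)

Section measurability.
Variable R : realType.
Implicit Types (m : nat).

Notation sizes m rho := (RW_step_sizes m.+1 0 rho).

Lemma measurable_floor_pred (Q : pred int) :
  measurable_fun setT (fun r : R => Q (Num.floor r)).
Proof.
apply: (measurable_fun_bool true); rewrite setTI.
rewrite (_ : _ @^-1` _ = \bigcup_(z : int)
    (if Q z then `[z%:~R, (z + 1)%:~R[%classic else set0)).
  apply: countable_bigcupT_measurable => [|z]; first exact: countableP.
  by case: ifP.
apply/seteqP; split=> r /=.
  move=> Qr; exists (Num.floor r) => //; rewrite Qr /= in_itv /=.
  by rewrite floor_le_tmp floorD1_gt.
move=> [z _]; case: ifP => // Qz /=; rewrite in_itv /= => rz.
by rewrite (floor_def rz).
Qed.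

Lemma measurable_floorR :
  measurable_fun setT (fun r : R => (Num.floor r)%:~R : R).
Proof.
apply: nondecreasing_measurable => // a b ab.
by rewrite ler_int le_floor.
Qed.

Lemma measurable_is_int : measurable_fun setT (fun r : R => r \is a Num.int).
Proof.
under eq_fun do rewrite intrEfloor.
by apply: measurable_fun_eqr => //; exact: measurable_floorR.
Qed.

Lemma measurable_frac_part : measurable_fun setT (@frac_part R).
Proof. by apply: measurable_funB => //; exact: measurable_floorR. Qed.

Lemma measurable_sizes m :
  measurable_fun setT (fun r : R => (sizes m r).1) /\
  measurable_fun setT (fun r : R => (sizes m r).2).
Proof.
have h1 : measurable_fun setT
    (fun r : R => odd (m.+1 - 0 - 1) && ((0 < r) && (r < 1))).
  apply: measurable_and => //; apply: measurable_and.
    exact: measurable_fun_ltr.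
  exact: measurable_fun_ltr.
have h2 := @measurable_floor_pred
  (fun z => ~~ odd (absz z + (m.+1 - 0 - 1))).
split.
  rewrite (_ : (fun _ => _) = fun r : R => if r \is a Num.int then 1 else
      if odd (m.+1 - 0 - 1) && ((0 < r) && (r < 1)) then r else
      if ~~ odd (absz (Num.floor r) + (m.+1 - 0 - 1)) then frac_part r else 1).
    apply: measurable_fun_ifT => //; first exact: measurable_is_int.
    apply: measurable_fun_ifT => //; apply: measurable_fun_ifT => //.
    exact: measurable_frac_part.
  by apply/funext => r; rewrite /RW_step_sizes; do 3?case: ifP.
rewrite (_ : (fun _ => _) = fun r : R => if r \is a Num.int then 1 else
    if odd (m.+1 - 0 - 1) && ((0 < r) && (r < 1)) then 1 - r else
    if ~~ odd (absz (Num.floor r) + (m.+1 - 0 - 1)) then 1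
    else 1 - frac_part r).
  apply: measurable_fun_ifT => //; first exact: measurable_is_int.
  apply: measurable_fun_ifT => //; first exact: measurable_funB.
  apply: measurable_fun_ifT => //; apply: measurable_funB => //.
  exact: measurable_frac_part.
by apply/funext => r; rewrite /RW_step_sizes; do 3?case: ifP.
Qed.

(** Unlike [sizes_bounds] this has no sign condition, because measurability is proved on the whole
    line. *)
Lemma sizes_sum_ge1 m (r : R) : 1 <= (sizes m r).1 + (sizes m r).2.
Proof.
have h1 : 0 <= frac_part r by rewrite /frac_part subr_ge0 floor_le_tmp.
have h2 : frac_part r <= 1.
  have := floorD1_gt r; rewrite /frac_part rmorphD /=; lra.
by rewrite /RW_step_sizes; do 3?case: ifP => _ /=; lra.
Qed.

Lemma measurable_sizes_sumV m :
  measurable_fun setT (fun r : R => ((sizes m r).1 + (sizes m r).2)^-1).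
Proof.
have [m1 m2] := measurable_sizes m.
rewrite (_ : (fun _ => _) = (fun z : R => (Num.max z 1)^-1) \o
    (fun r : R => (sizes m r).1 + (sizes m r).2)).
  apply: measurableT_comp; last exact: measurable_funD.
  apply: nonincreasing_measurable => // a b ab.
  by rewrite lef_pV2 ?posrE ?lt_max ?ltr01 ?orbT// ge_max !le_max ab lexx orbT.
by apply/funext => r /=; rewrite max_l// sizes_sum_ge1.
Qed.

Lemma measurable_win m : measurable_fun setT (@win R m).
Proof.
have h0 : measurable_fun setT (fun r : R => r <= 0) by exact: measurable_fun_ler.
elim: m => [|m IH].
  rewrite (_ : win 0 = fun r : R => if r <= 0 then 1 else 0) //.
  exact: measurable_fun_ifT.
have [m1 m2] := measurable_sizes m.
rewrite (_ : win m.+1 = fun r : R => if r <= 0 then 1 else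
    ((sizes m r).2 * win m (r - (sizes m r).1) +
     (sizes m r).1 * win m (r + (sizes m r).2)) *
    ((sizes m r).1 + (sizes m r).2)^-1); last first.
  apply/funext => r; case: ifPn => [|/negbTE r0]; first exact: win_le0.
  by rewrite winS// ltNge r0.
apply: measurable_fun_ifT => //; apply: measurable_funM.
  apply: measurable_funD; apply: measurable_funM => //;
    apply: (measurableT_comp IH).
    exact: measurable_funB.
  exact: measurable_funD.
exact: measurable_sizes_sumV.
Qed.

Lemma measurable_win_slope m : measurable_fun setT (@win_slope R m).
Proof.
have [m1 m2] := measurable_sizes m.
apply: measurable_funM; last exact: measurable_sizes_sumV.
apply: measurable_funB; apply: (measurableT_comp (measurable_win m)).
  exact: measurable_funB.
exact: measurable_funD.
Qed.

End measurability.

(** * Orthogonality of a martingale difference to the past *)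

Section integration.
Context d (T : measurableType d) (R : realType) (P : probability T R).
Implicit Types (f g X Y : T -> R) (G : set (set T)).

Lemma integrable_norm_le1 f : measurable_fun setT f ->
  (forall w, `|f w| <= 1) -> P.-integrable setT (EFin \o f).
Proof.
move=> mf f1; apply: measurable_bounded_integrable => //.
  by rewrite [X in (X < _)%E](@probability_setT _ _ _ P) ltry.
exists 1; split; first exact: num_real.
by move=> M M1 w _ /=; rewrite (le_trans (f1 w))// ltW.
Qed.

Lemma integrable_mul_norm_le1 f g : measurable_fun setT f ->
  (forall w, `|f w| <= 1) -> P.-integrable setT (EFin \o g) ->
  P.-integrable setT (EFin \o (fun w => f w * g w)).
Proof.
move=> mf f1 ig.
have -> : EFin \o (fun w => f w * g w) = ((EFin \o f) \* (EFin \o g))%E.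
  by apply/funext => w /=; rewrite EFinM.
apply: integrableMr => //.
exists 1; split; first exact: num_real.
by move=> M M1 w _ /=; rewrite (le_trans (f1 w))// ltW.
Qed.

Lemma ae_le_Rintegral f g :
  P.-integrable setT (EFin \o f) -> P.-integrable setT (EFin \o g) ->
  {ae P, forall w, f w <= g w} -> \int[P]_w f w <= \int[P]_w g w.
Proof.
move=> fi gi fg; pose h w := g w - f w.
have hi : P.-integrable setT (EFin \o h).
  have -> : EFin \o h = ((EFin \o g) \- (EFin \o f))%E.
    by apply/funext => w /=; rewrite EFinB.
  exact: integrableB.
have mh : measurable_fun setT h.
  by apply/measurable_EFinP; exact: measurable_int hi.
have -> : \int[P]_w g w = \int[P]_w f w + \int[P]_w h w.
  rewrite -RintegralD//; apply: eq_Rintegral => w _.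
  by rewrite /h addrC subrK.
rewrite lerDl /Rintegral fine_ge0//.
rewrite (ae_eq_integral (fun w => (Num.max (h w) 0)%:E))//.
- by apply: integral_ge0 => w _; rewrite lee_fin le_max lexx orbT.
- exact/measurable_EFinP.
- by apply/measurable_EFinP; exact: measurable_maxr.
- by apply: filterS fg => w fgw _; rewrite max_l// subr_ge0.
Qed.

(** Makes the closure rules for measurable functions available for a sub-sigma-algebra. *)
Lemma measurable_wrtP G Y : sigma_algebra setT G ->
  measurable_wrt G Y <->
  measurable_fun (setT : set (g_sigma_algebraType G)) (Y : g_sigma_algebraType G -> R).
Proof.
move=> sG; split=> [mY _ B mB|mY _ [B mB <-]].
  rewrite /measurable /= sigma_algebra_id//; apply: mY.
  by exists B.
have := mY measurableT B mB.
by rewrite /measurable /= sigma_algebra_id.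
Qed.

(** The hypothesis only gives vanishing integrals over sets of [G]. Rounding [Y] down to a grid of
    mesh [1 / M.+1] gives a function constant on countably many such sets, and the error is at most
    the mesh times the integral of the absolute value of [X]. *)
Lemma cond_mean0_orthogonal G X Y :
  sigma_algebra setT G -> G `<=` measurable ->
  is_cond_expectation P G X (cst 0) -> measurable_wrt G Y ->
  (forall w, `|Y w| <= 1) -> \int[P]_w (Y w * X w) = 0.
Proof.
move=> sG Gm [iX _ _ EX] mY Y1.
have mfY : measurable_fun setT Y.
  by move=> _ B mB; apply: Gm; apply: mY; exists B.
have iYX := integrable_mul_norm_le1 mfY Y1 iX.
(* The shift by 1 makes the floor nonnegative, so that the level sets are indexed by [nat]. *)
pose fl (M : nat) w := Num.floor (M.+1%:R * (Y w + 1)).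
pose Z M w : R := (fl M w)%:~R / M.+1%:R - 1.
have Mp M : 0 < M.+1%:R :> R by rewrite ltr0n.
have YZ M w : 0 <= Y w - Z M w <= M.+1%:R^-1.
  have := floor_le_tmp (M.+1%:R * (Y w + 1)).
  have := floorD1_gt (M.+1%:R * (Y w + 1)).
  rewrite -/(fl M w) rmorphD /= => h1 h2.
  have -> : Y w - Z M w = (M.+1%:R * (Y w + 1) - (fl M w)%:~R) / M.+1%:R.
    by rewrite /Z; field; apply/eqP => ?; have := ler0n R M; lra.
  apply/andP; split; first by rewrite divr_ge0 ?subr_ge0// ltW.
  by rewrite ler_pdivrMr// mulVf ?gt_eqF//; lra.
have mZ M : measurable_fun setT (Z M).
  apply: measurable_funB => //; apply: measurable_funM => //.
  apply: (measurableT_comp (@measurable_floorR R)).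
  by apply: measurable_funM => //; exact: measurable_funD.
pose A M (k : nat) := [set w | fl M w = k%:Z].
have GA M k : G (A M k).
  apply: mY; exists [set y : R | Num.floor (M.+1%:R * (y + 1)) == k%:Z].
    have mf : measurable_fun setT (fun y : R => M.+1%:R * (y + 1)).
      by apply: measurable_funM => //; exact: measurable_funD.
    have := measurableT_comp (@measurable_floor_pred R (pred1 k%:Z)) mf.
    by move=> /(_ measurableT [set true]); rewrite setTI; apply.
  by rewrite setTI; apply/seteqP; split=> w /= /eqP.
have YZ1 M w : `|Y w - Z M w| <= 1.
  have /andP[h1 h2] := YZ M w; rewrite ger0_norm// (le_trans h2)//.
  by rewrite invf_le1// ler1n.
have mYZ M : measurable_fun setT (fun w => Y w - Z M w).
  exact: measurable_funB.
have iYZX M := integrable_mul_norm_le1 (mYZ M) (YZ1 M) iX.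
have iZX M : P.-integrable setT (EFin \o (fun w => Z M w * X w)).
  have -> : EFin \o (fun w => Z M w * X w) =
      ((EFin \o (fun w => (Y w * X w)%R)) \-
       (EFin \o (fun w => ((Y w - Z M w) * X w)%R)))%E.
    apply/funext => w /=; rewrite -EFinB; congr EFin; ring.
  exact: integrableB.
have AT M : \bigcup_k A M k = setT.
  apply/seteqP; split=> // w _; exists (absz (fl M w)) => //.
  rewrite /A /= gez0_abs// floor_ge0 mulr_ge0//.
  by have := Y1 w; rewrite ler_norml => /andP[h _]; lra.
have ZX0 M : \int[P]_w (Z M w * X w) = 0.
  rewrite /Rintegral -(AT M) integral_bigcup.
  - rewrite eseries0// => k _ _.
    have -> : (\int[P]_(w in A M k) (Z M w * X w)%:E =
        \int[P]_(w in A M k) ((k%:R / M.+1%:R - 1)%:E * (X w)%:E))%E.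
      apply: eq_integral => w; rewrite inE /A /= => Aw.
      by rewrite /Z /= Aw -EFinM.
    rewrite integralZl//; last by apply: integrableS iX => //; exact: Gm.
      by rewrite -EX// integral0 mule0.
    exact: Gm.
  - apply/trivIsetP => i j _ _; apply: contraNeq => /set0P[w [/= Ai Aj]].
    by apply/eqP; move: Ai; rewrite /A /= Aj => -[].
  - by move=> k; exact: Gm.
  - by rewrite AT; exact: iZX.
pose K := \int[P]_w `|X w|.
have K0 : 0 <= K by apply: Rintegral_ge0.
have bound M : `|\int[P]_w (Y w * X w)| <= M.+1%:R^-1 * K.
  have -> : \int[P]_w (Y w * X w) = \int[P]_w ((Y w - Z M w) * X w).
    rewrite -[RHS]addr0 -(ZX0 M) -RintegralD//.
    by apply: eq_Rintegral => w _; ring.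
  apply: (le_trans (le_normr_Rintegral measurableT (iYZX M))).
  have iaX : P.-integrable setT (EFin \o (fun w => `|X w|)).
    exact: integrable_norm.
  rewrite /K -RintegralZl//; apply: le_Rintegral => //.
  - exact: integrable_norm.
  - have -> : EFin \o (fun w => M.+1%:R^-1 * `|X w|) =
        (fun w => (M.+1%:R^-1)%:E * (EFin \o (fun w => `|X w|%R)) w)%E.
      by apply/funext => w /=; rewrite EFinM.
    exact: integrableZl.
  - move=> w _; rewrite normrM ler_wpM2r//.
    by have /andP[h1 h2] := YZ M w; rewrite ger0_norm.
apply/eqP; rewrite -normr_le0; apply/ler_addgt0Pr => e e0; rewrite add0r.
have [M hM] : exists M : nat, K / e <= M.+1%:R.
  exists (Num.bound (K / e)); rewrite ltW// (lt_trans (archi_boundP _))//.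
    by rewrite divr_ge0// ltW.
  by rewrite ltr_nat.
rewrite (le_trans (bound M))// mulrC ler_pdivrMr// mulrC.
by rewrite -ler_pdivrMr.
Qed.

End integration.

(** * The bound for martingale walks *)

Section martingale_bound.
Context d (T : measurableType d) (R : realType) (P : probability T R).
Variables (n : nat) (x : R).
Implicit Types (W : nat -> T -> R) (k m : nat).

Notation sizes m rho := (RW_step_sizes m.+1 0 rho).

Definition hit W k w := has (fun i => x <= W i w) (iota 0 k.+1).

Lemma hit0 W w : hit W 0 w = (x <= W 0%N w).
Proof. by rewrite /hit /= orbF. Qed.

Lemma hitS W k w : hit W k.+1 w = hit W k w || (x <= W k.+1 w).
Proof. by rewrite /hit -(addn1 k.+1) iotaD has_cat /= orbF add0n. Qed.

Lemma hitP W k w : reflect (visits k W x w) (hit W k w).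
Proof.
apply: (iffP hasP) => [[i]|[i [ik xi]]].
  by rewrite mem_iota add0n ltnS => /= ik xi; exists i.
by exists i => //; rewrite mem_iota add0n ltnS.
Qed.

Lemma hitN_lt W k w : ~~ hit W k w -> W k w < x.
Proof.
case: k => [|k]; first by rewrite hit0 -ltNge.
by rewrite hitS negb_or -ltNge => /andP[].
Qed.

(* An upper bound for the probability, given the first k steps, that the walk
   visits [x, oo) within n steps. *)
Definition value W k w : R :=
  if hit W k w then 1 else win (n - k) (x - W k w).

Definition value_slope W k w : R :=
  if hit W k w then 0 else win_slope (n - k.+1) (x - W k w).

Lemma value_norm_le1 W k w : `|value W k w| <= 1.
Proof.
rewrite /value; case: ifP => _; first by rewrite normr1.
by have /andP[h1 h2] := win_bounds (n - k) (x - W k w); rewrite ger0_norm.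
Qed.

Lemma value_slope_norm_le1 W k w : `|value_slope W k w| <= 1.
Proof.
rewrite /value_slope; case: ifPn => h; first by rewrite normr0.
by apply: win_slope_le1; rewrite subr_gt0 hitN_lt.
Qed.

Lemma valueS W k w : ~~ hit W k w ->
  value W k.+1 w = win (n - k.+1) (x - W k w - step W k w).
Proof.
move=> h; have -> : x - W k w - step W k w = x - W k.+1 w.
  by rewrite /step; ring.
rewrite /value hitS (negbTE h) /=; case: ifP => // xW.
by rewrite win_le0// subr_le0.
Qed.

Lemma value_step_le W k w : (k < n)%N -> `|step W k w| <= 1 ->
  value W k.+1 w <= value W k w + value_slope W k w * step W k w.
Proof.
move=> kn s1; have [h|h] := boolP (hit W k w).
  rewrite {2}/value /value_slope h mul0r addr0.
  exact: le_trans (ler_norm _) (value_norm_le1 _ _ _).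
rewrite valueS// /value /value_slope (negbTE h) -(subnSK kn).
by apply: win_tangent => //; rewrite subr_gt0 hitN_lt.
Qed.

Lemma value_step_eq W k w : (k < n)%N -> (~~ hit W k w ->
    let s := RW_step_sizes n k (x - W k w) in
    step W k w = s.1 \/ step W k w = - s.2) ->
  value W k.+1 w = value W k w + value_slope W k w * step W k w.
Proof.
move=> kn hs; have [h|h] := boolP (hit W k w).
  by rewrite /value /value_slope hitS h mul0r addr0.
rewrite valueS// /value /value_slope (negbTE h) -(subnSK kn).
apply: win_tangent_step; first by rewrite subr_gt0 hitN_lt.
by have := hs h; rewrite RW_step_sizesE.
Qed.

(** Stated for an arbitrary measurable type, to serve both the ambient space and the sigma-algebras
    of the filtration. *)
Lemma measurable_hit d' (T' : measurableType d') (V : nat -> T' -> R) k :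
  (forall i, (i <= k)%N -> measurable_fun setT (V i)) ->
  measurable_fun setT (fun w => has (fun i => x <= V i w) (iota 0 k.+1)).
Proof.
elim: k => [|k IH] mV.
  rewrite (_ : (fun _ => _) = fun w => x <= V 0%N w).
    by apply: measurable_fun_ler => //; exact: mV.
  by apply/funext => w /=; rewrite orbF.
rewrite (_ : (fun _ => _) = fun w =>
    has (fun i => x <= V i w) (iota 0 k.+1) || (x <= V k.+1 w)).
  apply: measurable_or; first by apply: IH => i ik; apply: mV; exact: leqW.
  by apply: measurable_fun_ler => //; exact: mV.
by apply/funext => w; rewrite -(addn1 k.+1) iotaD has_cat /= orbF add0n.
Qed.

Lemma filtration_le (F : nat -> set (set T)) i k :
  is_filtration n F -> (i <= k)%N -> (k <= n)%N -> F i `<=` F k.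
Proof.
move=> [_ _ FS]; elim: k => [|k IH].
  by rewrite leqn0 => /eqP -> _; exact: subset_refl.
rewrite leq_eqVlt => /predU1P[-> _|ik kn]; first exact: subset_refl.
by apply: subset_trans (FS _ kn); exact: IH (ltnW kn).
Qed.

Section walk.
Variable W : nat -> T -> R.
Hypothesis mW : martingale_walk P n W.

Lemma martingale_walk_measurable k : (k <= n)%N -> measurable_fun setT (W k).
Proof.
move=> kn; have [_ [F [[_ Fm _] WF _ _]]] := mW.
by move=> _ B mB; apply: (Fm _ kn); apply: (WF _ kn); exists B.
Qed.

Lemma measurable_value k : (k <= n)%N -> measurable_fun setT (value W k).
Proof.
move=> kn; apply: measurable_fun_ifT => //.
  apply: measurable_hit => i ik.
  exact/martingale_walk_measurable/(leq_trans ik).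
apply: (measurableT_comp (@measurable_win R _)).
by apply: measurable_funB => //; exact: martingale_walk_measurable.
Qed.

Lemma integrable_value k : (k <= n)%N ->
  P.-integrable setT (EFin \o value W k).
Proof.
move=> kn; apply: integrable_norm_le1 (measurable_value kn) _ => w.
exact: value_norm_le1.
Qed.

Lemma value_slope_orthogonal k : (k < n)%N ->
  P.-integrable setT (EFin \o (fun w => value_slope W k w * step W k w)) /\
  \int[P]_w (value_slope W k w * step W k w) = 0.
Proof.
move=> kn; have [_ [F [[sF Fm Fi] WF EF _]]] := mW.
have kn' := ltnW kn.
have Fle i : (i <= k)%N -> F i `<=` F k 
  by move=> ik; apply: (@filtration_le F).
have wrt : measurable_wrt (F k) (value_slope W k).
  apply/(measurable_wrtP _ (sF _ kn')).
  apply: measurable_fun_ifT => //.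
    apply: (@measurable_hit _ (g_sigma_algebraType (F k))) => i ik.
    apply/(measurable_wrtP _ (sF _ kn')) => A mA; apply: (Fle _ ik).
    by apply: (WF _ (leq_trans ik kn')).
  apply: (measurableT_comp (@measurable_win_slope R _)).
  apply: measurable_funB => //.
  by apply/(measurable_wrtP _ (sF _ kn')); exact: WF.
split.
  apply: integrable_mul_norm_le1.
  - by move=> _ B mB; apply: (Fm _ kn'); apply: wrt; exists B.
  - exact: value_slope_norm_le1.
  - by have [] := EF _ kn.
apply: (cond_mean0_orthogonal (sF _ kn') (Fm _ kn') (EF _ kn) wrt).
exact: value_slope_norm_le1.
Qed.

Lemma Rintegral_valueS k : (k < n)%N ->
  P.-integrable setT
    (EFin \o (fun w => value W k w + value_slope W k w * step W k w)) /\
  \int[P]_w (value W k w + value_slope W k w * step W k w) =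
  \int[P]_w value W k w.
Proof.
move=> kn; have [iS S0] := value_slope_orthogonal kn.
have iv := integrable_value (ltnW kn); split; last first.
  by rewrite RintegralD// S0 addr0.
rewrite (_ : EFin \o _ = (EFin \o value W k) \+
    (EFin \o (fun w => (value_slope W k w * step W k w)%R)))%E.
  exact: integrableD.
by apply/funext => w /=; rewrite EFinD.
Qed.

Lemma Rintegral_value0 : \int[P]_w value W 0 w = win n x.
Proof.
rewrite (_ : value W 0 = cst (win n x)).
  by rewrite Rintegral_cst// [X in fine X](@probability_setT _ _ _ P) mulr1.
apply/funext => w; have [W0 _] := mW.
rewrite /value hit0 W0 subn0 subr0; case: ifP => // x0.
by rewrite win_le0.
Qed.

Lemma measurable_visits k : (k <= n)%N -> measurable (visits k W x).
Proof.
move=> kn; have mh : measurable_fun setT (hit W k).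
  apply: measurable_hit => i ik.
  exact/martingale_walk_measurable/(leq_trans ik).
rewrite (_ : visits k W x = setT `&` hit W k @^-1` [set true]); first exact: mh.
by rewrite setTI; apply/seteqP; split=> w /= /(hitP W).
Qed.

(** With no step left [win 0] vanishes at positive distances, so the final value is an indicator. *)
Lemma prob_visits : P (visits n W x) = (\int[P]_w value W n w)%:E.
Proof.
rewrite (_ : value W n = \1_(visits n W x)).
  rewrite /Rintegral integral_indic ?setIT//; last exact: measurable_visits.
  by rewrite fineK// fin_num_measure//; exact: measurable_visits.
apply/funext => w; rewrite indicE /value subnn.
case: hitP => h; first by rewrite mem_set.
rewrite memNset// win0_gt0// subr_gt0 hitN_lt//.
by apply/negP => /(hitP W).
Qed.

Lemma visits_le_win : (P (visits n W x) <= (win n x)%:E)%E.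
Proof.
rewrite prob_visits lee_fin -Rintegral_value0.
have [_ [F [_ _ _ s1]]] := mW.
suff : forall k, (k <= n)%N ->
  \int[P]_w value W k w <= \int[P]_w value W 0 w by apply.
elim=> [//|k IH] kn; apply: le_trans (IH (ltnW kn)).
have [iD <-] := Rintegral_valueS kn.
apply: ae_le_Rintegral => //; first exact: integrable_value.
by apply: filterS (s1 _ kn) => w; exact: value_step_le.
Qed.

Lemma visits_eq_win :
  (forall k, (k < n)%N -> {ae P, forall w, ~~ hit W k w ->
    let s := RW_step_sizes n k (x - W k w) in
    step W k w = s.1 \/ step W k w = - s.2}) ->
  P (visits n W x) = (win n x)%:E.
Proof.
move=> s2; rewrite prob_visits -Rintegral_value0; congr EFin.
suff : forall k, (k <= n)%N ->
  \int[P]_w value W k w = \int[P]_w value W 0 w by apply.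
elim=> [//|k IH] kn; rewrite -(IH (ltnW kn)).
have [iD <-] := Rintegral_valueS kn.
apply/eqP; rewrite eq_le; apply/andP; split; apply: ae_le_Rintegral => //;
  (try exact: integrable_value);
  by apply: filterS (s2 _ kn) => w /(value_step_eq kn) ->.
Qed.

End walk.

End martingale_bound.

(** * The stopped walk *)

Section stopped.
Context d (T : measurableType d) (R : realType).
Variables (n : nat) (x : R) (W : nat -> T -> R).
Implicit Types (k i : nat) (w : T).

Local Notation S := (stopped n W x).

Lemma hitting_time_le k w :
  (k <= n)%N -> (hitting_time n W x w <= k)%N = hit x W k w.
Proof.
move=> kn; rewrite /hit -[iota 0 k.+1](_ : take k.+1 (iota 0 n.+1) = _).
  by rewrite has_take_leq ?size_iota// ltnS.
by rewrite take_iota; congr iota; apply/minn_idPl.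
Qed.

Lemma hit_mono i k w : (i <= k)%N -> hit x W i w -> hit x W k w.
Proof.
move=> ik /(hitP x W) [j [ji xj]]; apply/(hitP x W).
by exists j; split => //; exact: leq_trans ik.
Qed.

Lemma stopped_notin k w : (k <= n)%N -> ~~ hit x W k w -> S k w = W k w.
Proof.
move=> kn; rewrite -hitting_time_le// -ltnNge => h.
by rewrite /stopped; congr (W _ w); apply/minn_idPr/ltnW.
Qed.

Lemma stoppedS k w : (k < n)%N ->
  S k.+1 w = if hit x W k w then S k w else W k.+1 w.
Proof.
move=> kn; rewrite -hitting_time_le ?(ltnW kn)//; case: leqP => h.
  by rewrite /stopped; congr (W _ w); rewrite !(minn_idPl _)// leqW.
by rewrite /stopped; congr (W _ w); apply/minn_idPr.
Qed.

Lemma step_stopped k w : (k < n)%N ->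
  step S k w = if hit x W k w then 0 else step W k w.
Proof.
move=> kn; rewrite /step stoppedS//; case: ifPn => h; first by rewrite subrr.
by rewrite stopped_notin// ltnW.
Qed.

Lemma hit_stopped k w : (k <= n)%N -> hit x S k w = hit x W k w.
Proof.
move=> kn; have [h|h] := boolP (hit x W k w).
  have tk : (hitting_time n W x w <= k)%N by rewrite hitting_time_le.
  apply/hitP; exists k; split => //; rewrite /stopped (minn_idPl tk).
  have hs : has (fun k => x <= W k w) (iota 0 n.+1) by exact: hit_mono kn h.
  have := nth_find 0%N hs; rewrite nth_iota// -?/(hitting_time n W x w) ?add0n//.
  by rewrite ltnS (leq_trans tk).
apply/negbTE; apply: contra h => /hitP [i [ik xi]]; apply/negbNE/negP => h.
have hi : ~~ hit x W i w by apply: contra h; exact: hit_mono.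
move: xi; rewrite stopped_notin ?(leq_trans ik)// leNgt => /negP; apply.
exact: hitN_lt hi.
Qed.

Lemma visits_stopped : visits n S x = [set w | x <= S n w].
Proof.
apply/seteqP; split=> w /=; last by move=> h; exists n.
move=> /(hitP x S); rewrite hit_stopped// => h.
have tk : (hitting_time n W x w <= n)%N by rewrite hitting_time_le.
rewrite /stopped (minn_idPl tk); have := nth_find 0%N h.
by rewrite nth_iota// -?/(hitting_time n W x w) ?add0n.
Qed.

Lemma measurable_stopped k : (forall i, (i <= n)%N -> measurable_fun setT (W i)) ->
  (k <= n)%N -> measurable_fun setT (S k).
Proof.
move=> mW; elim: k => [|k IH] kn.
  rewrite (_ : S 0 = W 0); first exact: mW.
  by apply/funext => w; rewrite /stopped minn0.
rewrite (_ : S k.+1 = fun w => if hit x W k w then S k w else W k.+1 w).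
  apply: measurable_fun_ifT; [|exact: IH (ltnW kn)|exact: mW].
  by apply: measurable_hit => i ik; apply: mW; rewrite (leq_trans ik)// ltnW.
by apply/funext => w; rewrite stoppedS.
Qed.

End stopped.

(** * Almost sure trajectories of RW *)

Section stopped_walk_martingale.
Context d (T : measurableType d) (R : realType) (P : probability T R).
Variables (n : nat) (x : R) (W : nat -> T -> R).
Hypothesis RW : is_RW P n x W.
Implicit Types (k i m : nat) (w : T) (s : seq bool).

Local Notation S := (stopped n W x).

(* The trajectory of the unstopped walk in which the bits of s tell whether
   the successive steps go towards the target. *)
Fixpoint trajectory s k : R :=
  if k is k'.+1 then
    let z := RW_step_sizes n k' (x - trajectory s k') in
    if nth false s k' then trajectory s k' + z.1 else trajectory s k' - z.2
  else 0.

Lemma eq_trajectory s s' k :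
  (forall i, (i < k)%N -> nth false s i = nth false s' i) ->
  trajectory s k = trajectory s' k.
Proof.
elim: k => [//|k IH] ss' /=; rewrite IH; last first.
  by move=> i ik; apply: ss'; exact: ltnW.
by rewrite ss'.
Qed.

Definition past k (a : nat -> R) : set T :=
  [set w | forall i, (i <= k)%N -> W i w = a i].

Lemma measurable_past k a : (k <= n)%N -> measurable (past k a).
Proof.
move=> kn; have [_ mW _] := RW.
rewrite (_ : past k a = \bigcap_(i in [set i | (i <= k)%N]) (W i @^-1` [set a i])).
  apply: bigcap_measurable; first by exists 0%N.
  move=> i /= ik; rewrite -[_ @^-1` _]setTI; apply: mW => //.
  exact: leq_trans kn.
by apply/seteqP; split=> w /= h i; exact: h.
Qed.

Definition RW_step k w : Prop :=
  let z := RW_step_sizes n k (x - W k w) in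
  step W k w = z.1 \/ step W k w = - z.2.

Lemma measurable_step_eq k (c : R) : (k < n)%N ->
  measurable [set w | W k.+1 w = c].
Proof.
move=> kn; have [_ mW _] := RW.
rewrite (_ : [set w | _] = setT `&` W k.+1 @^-1` [set c]) ?setTI//.
by rewrite -[X in measurable X]setTI; apply: mW.
Qed.

(** The two prescribed events are disjoint and their probabilities add up to that of the history. *)
Lemma ae_RW_step_past k s : (k < n)%N -> trajectory s k < x ->
  {ae P, forall w, past k (trajectory s) w -> RW_step k w}.
Proof.
move=> kn sx; have [_ mW law] := RW.
have := law k (trajectory s) kn sx.
have r0 : 0 < x - trajectory s k by rewrite subr_gt0.
have := sizes_bounds (n - k.+1) r0; rewrite -RW_step_sizesE//.
case E : (RW_step_sizes n k (x - trajectory s k)) => [sl sr] /= [b1 b2 b3].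
rewrite -/(past k (trajectory s)); set a := trajectory s.
set E1 := [set w | W k.+1 w = a k + sl]; set E2 := [set w | W k.+1 w = a k - sr].
move=> [p1 p2].
have mp : measurable (past k a) by apply: measurable_past; exact: ltnW.
have mE1 : measurable E1 by exact: measurable_step_eq.
have mE2 : measurable E2 by exact: measurable_step_eq.
exists (past k a `\` (E1 `|` E2)); split.
- by apply: measurableD => //; exact: measurableU.
- have PU : P (past k a `&` (E1 `|` E2)) = P (past k a).
    have dis : (past k a `&` E1) `&` (past k a `&` E2) = set0.
      apply/seteqP; split=> // w /= [[_ h1] [_ h2]].
      by rewrite /E1 /E2 /= in h1 h2; exfalso; lra.
    have := measureU P (measurableI _ _ mp mE1) (measurableI _ _ mp mE2) dis.
    rewrite -setIUr => ->; transitivity ((sr / (sl + sr))%:E * P (past k a) +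
        (sl / (sl + sr))%:E * P (past k a))%E; first by rewrite -p1 -p2.
    have q1 : 0 <= sr / (sl + sr) by rewrite divr_ge0//; lra.
    have q2 : 0 <= sl / (sl + sr) by rewrite divr_ge0//; lra.
    rewrite -ge0_muleDl ?lee_fin//.
    rewrite -EFinD -mulrDl [sr + sl]addrC divff ?mul1e//.
    by apply/eqP => ?; lra.
  have fP : P (past k a) \is a fin_num by exact: fin_num_measure.
  have fP' : (P (past k a) < +oo)%E by rewrite ltey_eq fP.
  have PD := measureD mp (measurableU _ _ mE1 mE2) fP'.
  by apply: (eq_trans PD); rewrite -[RHS](subee fP); congr (_ - _)%E.
- move=> w /= /not_implyP[pw ns]; split=> //; apply: contra_not ns => h.
  have Wk : W k w = a k by exact: pw.
  rewrite /RW_step Wk E /step Wk /=.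
  by case: h => -> ; [left|right]; ring.
Qed.

(** One null set must serve all histories; bit strings, enumerated through [pickle], make them
    countable. *)
Lemma ae_RW_step_trajectory : {ae P, forall w k s, (k < n)%N ->
  trajectory s k < x -> past k (trajectory s) w -> RW_step k w}.
Proof.
suff : {ae P, forall w (k : nat) (i : nat), (k < n)%N ->
    let s := odflt [::] (unpickle i) in
    trajectory s k < x -> past k (trajectory s) w -> RW_step k w}.
  by apply: filterS => w h k s kn; have := h k (pickle s) kn; rewrite pickleK.
apply: ae_foralln => k; apply: ae_foralln => i.
have [kn|kn] := boolP (k < n)%N; last by apply: filterE.
set s := odflt _ _.
have [sx|sx] := boolP (trajectory s k < x); last first.
  by apply: filterE => w _ /= h; rewrite h in sx.
by apply: filterS (ae_RW_step_past kn sx) => w h _ s' _; exact: h.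
Qed.

Lemma ae_trajectory : {ae P, forall w k, (k <= n)%N -> ~~ hit x W k w ->
  exists s, past k (trajectory s) w}.
Proof.
apply: filterS ae_RW_step_trajectory => w h k kn hk.
(* Fixing the length to [k] ensures that the bit appended by [rcons] is the one read at step [k]. *)
suff [s [_ ps]] : exists s, size s = k /\ past k (trajectory s) w by exists s.
elim: k kn hk => [|k IH] kn hk.
  exists [::]; split => // i; rewrite leqn0 => /eqP ->.
  by have [-> _ _] := RW.
have hk' : ~~ hit x W k w by apply: contra hk; exact: hit_mono.
have [s [ss ps]] := IH (ltnW kn) hk'.
have Wk : W k w = trajectory s k by exact: ps.
have sx : trajectory s k < x by rewrite -Wk hitN_lt.
have ext c i : (i <= k)%N -> trajectory (rcons s c) i = trajectory s i.
  move=> ik; apply: eq_trajectory => j ji.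
  by rewrite nth_rcons ss (leq_trans ji ik).
have nthc c : nth false (rcons s c) k = c by rewrite nth_rcons ss ltnn eqxx.
have WS : W k.+1 w = W k w + step W k w by rewrite /step; ring.
have [st|st] := h k s kn sx ps.
  exists (rcons s true); split; first by rewrite size_rcons ss.
  move=> i; rewrite leq_eqVlt => /predU1P[->|]; last first.
    by rewrite ltnS => ik; rewrite ext// ps.
  by rewrite [RHS]/= nthc ext// -Wk -st WS.
exists (rcons s false); split; first by rewrite size_rcons ss.
move=> i; rewrite leq_eqVlt => /predU1P[->|]; last first.
  by rewrite ltnS => ik; rewrite ext// ps.
by rewrite [RHS]/= nthc ext// -Wk -st WS.
Qed.

Lemma ae_RW_step : {ae P, forall w k, (k < n)%N -> ~~ hit x W k w ->
  RW_step k w}.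
Proof.
apply: filterS2 ae_RW_step_trajectory ae_trajectory => w h1 h2 k kn hk.
have [s ps] := h2 k (ltnW kn) hk; apply: (h1 k s kn _ ps).
by rewrite -(ps k)// hitN_lt.
Qed.

Lemma ae_step_stopped_le1 :
  {ae P, forall w k, (k < n)%N -> `|step S k w| <= 1}.
Proof.
apply: filterS ae_RW_step => w h k kn; rewrite step_stopped//.
case: ifPn => hk; first by rewrite normr0.
have r0 : 0 < x - W k w by rewrite subr_gt0 hitN_lt.
have := sizes_bounds (n - k.+1) r0; rewrite -RW_step_sizesE// => -[b1 b2 b3].
by have [->|->] := h k kn hk; rewrite ?normrN ger0_norm; lra.
Qed.

End stopped_walk_martingale.

(** * The martingale property of the stopped RW *)

Section stopped_filtration.
Context d (T : measurableType d) (R : realType) (P : probability T R).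
Variables (n : nat) (x : R) (W : nat -> T -> R).
Hypothesis RW : is_RW P n x W.
Implicit Types (k i m : nat) (w : T) (s : seq bool) (A : set T).

Local Notation S := (stopped n W x).
Local Notation past := (past W).
Local Notation trajectory := (trajectory n x).

(* The events determined by the first k steps of the stopped walk: its history
   takes countably many values up to null sets, so nothing is lost by not
   generating the sigma-algebra by the positions. *)
Definition stopped_filtration k : set (set T) :=
  [set A | measurable A /\
    forall w w', (forall i, (i <= k)%N -> S i w = S i w') -> A w -> A w'].

Lemma stopped_filtrationP : is_filtration n stopped_filtration.
Proof.
split.
- move=> k kn; split.
  + by split.
  + move=> A [mA dA]; split; first exact: measurableD.
    move=> w w' ww' [_ nA]; split => // Aw'; apply: nA.
    by apply: dA Aw' => i ik; rewrite ww'.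
  + move=> A FA; split.
      by apply: bigcupT_measurable => i; have [] := FA i.
    move=> w w' ww' [i _ Aw]; exists i => //; have [_ dA] := FA i.
    exact: dA ww' Aw.
- by move=> k kn A [].
- move=> k kn A [mA dA]; split => // w w' ww'; apply: dA => i ik.
  by apply: ww'; exact: leqW.
Qed.

Lemma measurable_stoppedRW k : (k <= n)%N -> measurable_fun setT (S k).
Proof. by have [_ mW _] := RW; exact: measurable_stopped. Qed.

Lemma stopped_filtration_adapted k : (k <= n)%N ->
  measurable_wrt (stopped_filtration k) (S k).
Proof.
move=> kn _ [B mB <-]; split; first exact: measurable_stoppedRW.
by move=> w w' ww' [_ /= Bw]; split => //=; rewrite -ww'.
Qed.

Lemma measurable_step_stopped k : (k < n)%N -> measurable_fun setT (step S k).
Proof.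
by move=> kn; apply: measurable_funB; apply: measurable_stoppedRW => //; exact: ltnW.
Qed.

Lemma ae_step_stopped_norm_le1 k : (k < n)%N ->
  {ae P, forall w, `|step S k w| <= 1}.
Proof.
by move=> kn; apply: filterS (ae_step_stopped_le1 RW) => w; apply.
Qed.

Lemma integrable_step_stopped k : (k < n)%N ->
  P.-integrable setT (EFin \o step S k).
Proof.
move=> kn; have ms := measurable_step_stopped kn; apply/integrableP; split.
  exact/measurable_EFinP.
apply: (@le_lt_trans _ _ (1 * P setT)%E).
  apply: integral_le_bound => //; first exact/measurable_EFinP.
  by apply: filterS (ae_step_stopped_norm_le1 kn) => w h _; rewrite /= lee_fin.
by rewrite mul1e ltey_eq fin_num_measure.
Qed.

(** Mean zero on a single history: almost surely only the two prescribed steps occur, and their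
    contributions [sl * sr] and [sr * sl], over the same denominator, cancel. *)
Lemma integral_step_past k s : (k < n)%N -> trajectory s k < x ->
  past k (trajectory s) `<=` [set w | ~~ hit x W k w] ->
  (\int[P]_(w in past k (trajectory s)) (step S k w)%:E = 0)%E.
Proof.
move=> kn sx nh; have [_ mW law] := RW.
have := law k (trajectory s) kn sx.
have r0 : 0 < x - trajectory s k by rewrite subr_gt0.
have := sizes_bounds (n - k.+1) r0; rewrite -RW_step_sizesE//.
have ae := ae_RW_step_past RW kn sx.
case E : (RW_step_sizes n k (x - trajectory s k)) => [sl sr] /= [b1 b2 b3].
rewrite -/(past k (trajectory s)); move: nh ae; set a := trajectory s => nh ae.
set E1 := [set w | W k.+1 w = a k + sl]; set E2 := [set w | W k.+1 w = a k - sr].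
move=> [p1 p2].
have mp : measurable (past k a) by apply: (measurable_past RW); exact: ltnW.
have mE1 : measurable E1 by exact: (measurable_step_eq RW).
have mE2 : measurable E2 by exact: (measurable_step_eq RW).
have fP : P (past k a) \is a fin_num by exact: fin_num_measure.
have iI E0 : measurable E0 ->
    P.-integrable (past k a) (fun w => (\1_E0 w)%:E).
  move=> mE0; apply: (@integrableS _ _ _ _ setT) => //.
  apply: integrable_norm_le1 => [|w]; first exact: measurable_indic.
  by rewrite indicE; case: (_ \in _); rewrite ?normr1 ?normr0.
transitivity (\int[P]_(w in past k a)
    (sl%:E * (\1_E1 w)%:E - sr%:E * (\1_E2 w)%:E))%E.
  apply: ae_eq_integral => //.
  - apply/measurable_EFinP; apply: measurable_funS (measurable_step_stopped kn) => //.
  - apply/measurable_EFinP; apply: (@measurable_funS _ _ _ _ setT) => //.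
    by apply: measurable_funB; apply: measurable_funM => //;
      exact: measurable_indic.
  - apply: filterS ae => w h pw; have Wk : W k w = a k by exact: pw.
    rewrite step_stopped// (negbTE (nh _ pw)) -!EFinM -EFinB; congr EFin.
    have := h pw; rewrite /RW_step Wk E /= !indicE.
    have SE : W k.+1 w = a k + step W k w by rewrite /step Wk; ring.
    case=> st.
      rewrite mem_set ?memNset ?mulr1 ?mulr0 ?subr0//.
        by rewrite /E2 /= SE st => ?; lra.
      by rewrite /E1 /= SE st.
    rewrite memNset ?mem_set ?mulr1 ?mulr0 ?sub0r//.
      by rewrite /E2 /= SE st.
    by rewrite /E1 /= SE st => ?; lra.
rewrite integralB//; last 2 first.
- by apply: integrableZl => //; exact: iI.
- by apply: integrableZl => //; exact: iI.
rewrite !integralZl//; last 2 first.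
- exact: iI.
- exact: iI.
transitivity (sl%:E * P (past k a `&` E1) - sr%:E * P (past k a `&` E2))%E.
  by rewrite !integral_indic// ![_ `&` past k a]setIC.
rewrite p1 p2 -(fineK fP).
rewrite -!EFinM -EFinB; congr EFin; field; apply/eqP => ?; lra.
Qed.

End stopped_filtration.

Section stopped_RW.
Context d (T : measurableType d) (R : realType) (P : probability T R).
Variables (n : nat) (x : R) (W : nat -> T -> R).
Hypothesis RW : is_RW P n x W.
Implicit Types (k i m : nat) (w : T) (s : seq bool) (A : set T).

Local Notation S := (stopped n W x).

(** An event of the filtration contains or misses each history atom entirely, so
    [integral_step_past] can be summed over the atoms inside [A]. *)
Lemma integral_step_stopped k A : (k < n)%N ->
  stopped_filtration n x W k A ->
  (\int[P]_(w in A) (step S k w)%:E = 0)%E.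
Proof.
move=> kn [mA dA]; have kn' := ltnW kn.
pose a i := trajectory n x (odflt [::] (unpickle i)).
pose B i := [set w | (forall j, (j <= k)%N -> a i j < x) /\ past W k (a i) w].
have nh i w : B i w -> ~~ hit x W k w.
  move=> [ax pw]; apply/negP => /hitP[j [jk]].
  by rewrite pw// leNgt ax.
have BE i : (forall j, (j <= k)%N -> a i j < x) -> B i = past W k (a i).
  by move=> ax; apply/seteqP; split=> w // [].
have mB i : measurable (B i).
  have [ax|ax] := pselect (forall j, (j <= k)%N -> a i j < x).
    by rewrite BE//; exact: (measurable_past RW).
  by rewrite (_ : B i = set0)//; apply/seteqP; split=> w // [].
have Bhist i j w w' : B i w -> B i w' -> B j w -> B j w'.
  move=> [_ pw] [_ pw'] [ax qw]; split => // l lk.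
  by rewrite pw'// -(pw l)// qw.
pose U := \bigcup_i B i.
(* Outside these atoms the target has almost surely been reached by time [k], and the stopped walk
   no longer moves. *)
have step0 : {ae P, forall w, ~ U w -> step S k w = 0}.
  apply: filterS (ae_trajectory RW) => w h nU; rewrite step_stopped//.
  case: ifPn => // hk; have [s ps] := h k kn' hk.
  exfalso; apply: nU; exists (pickle s) => //.
  have aE : a (pickle s) = trajectory n x s by rewrite /a pickleK.
  split; rewrite aE// => j jk; rewrite -ps// hitN_lt//.
  by apply: contra hk; exact: hit_mono.
have is_ := integrable_step_stopped RW kn.
have ms : measurable_fun setT (step S k) by exact: (measurable_step_stopped RW).
have mU : measurable U by apply: bigcupT_measurable.
have -> : (\int[P]_(w in A) (step S k w)%:E =
    \int[P]_(w in A `&` U) (step S k w)%:E)%E.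
  rewrite integral_mkcondr; apply: ae_eq_integral => //.
  - by apply/measurable_EFinP; exact: measurable_funS ms.
  - apply/measurable_restrict => //; apply/measurable_EFinP.
    exact: measurable_funS ms.
  - apply: filterS step0 => w h _; rewrite patchE.
    by case: ifPn => // /negP nU; rewrite h// => Uw; apply: nU; rewrite inE.
(* Several bit strings code the same history, so the [B i] repeat. By [Bhist] two of them coincide
   or are disjoint; each piece [F i] is therefore empty or a full atom. *)
pose F i := A `&` seqDU B i.
have mD i : measurable (seqDU B i).
  by apply: measurableD => //; exact: bigsetU_measurable.
have AU : A `&` U = \bigcup_i F i by rewrite /U seqDU_bigcup_eq setI_bigcupr.
rewrite AU integral_bigcup.
- rewrite eseries0// => i _ _.
  have [->|/set0P[w [Aw [Bw nBw]]]] := eqVneq (F i) set0.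
    by rewrite integral_set0.
  have ax : forall j, (j <= k)%N -> a i j < x by case: Bw.
  have -> : F i = past W k (a i).
    rewrite -BE//; apply/seteqP; split=> [w' [_ []] //|w' Bw'].
    split.
      apply: dA Aw => j jk; have jn := leq_trans jk kn'.
      rewrite !stopped_notin//.
      + by case: Bw Bw' => _ pw [_ pw']; rewrite pw// pw'.
      + by apply: contra (nh _ _ Bw'); exact: hit_mono.
      + by apply: contra (nh _ _ Bw); exact: hit_mono.
    split => //; apply: contra_not nBw; rewrite -!bigcup_mkord => -[j ji Bj].
    by exists j => //; exact: Bhist Bw' Bw Bj.
  apply: (integral_step_past RW kn); first exact: ax.
  by move=> w' pw'; apply: (nh i); rewrite BE.
- apply/trivIsetP => i j _ _ ij; rewrite /F setIACA.
  have /trivIsetP /(_ i j Logic.I Logic.I ij) -> := @trivIset_seqDU _ B.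
  by rewrite setI0.
- by move=> i; exact: measurableI.
- rewrite -AU; apply: (@integrableS _ _ _ _ setT) => //.
  exact: measurableI.
Qed.

Lemma stopped_RW_martingale : martingale_walk P n S.
Proof.
split=> [w|].
  by have [W0 _ _] := RW; rewrite /stopped minn0 W0.
exists (stopped_filtration n x W); split.
- exact: stopped_filtrationP.
- exact: (stopped_filtration_adapted RW).
- move=> k kn; split.
  + exact: (integrable_step_stopped RW).
  + move=> _ [B mB <-]; split; last by [].
    by rewrite -[X in measurable X]setTI setIA setTI; exact: measurable_cst.
  + apply: (@integrable_norm_le1 _ _ _ P (cst 0)) => // w.
    by rewrite normr0.
  + by move=> A FA; rewrite integral_step_stopped// integral0.
- by move=> k kn; exact: (ae_step_stopped_norm_le1 RW).
Qed.

Lemma prob_visits_stopped_RW : P (visits n S x) = (win n x)%:E.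
Proof.
apply: (visits_eq_win stopped_RW_martingale) => k kn.
apply: filterS (ae_RW_step RW) => w h; have kn' := ltnW kn.
rewrite hit_stopped// => hk /=; rewrite step_stopped// (negbTE hk).
by rewrite stopped_notin//; exact: h.
Qed.

Lemma D_win : D n x = (win n x)%:E.
Proof.
apply/eqP; rewrite eq_le; apply/andP; split.
  apply: ub_ereal_sup => _ [d' [T' [P' [W' [mW ->]]]]].
  exact: visits_le_win.
rewrite -prob_visits_stopped_RW; apply: ereal_sup_ubound.
by exists d, T, P, S; split => //; exact: stopped_RW_martingale.
Qed.

End stopped_RW.

(** * Realizations of RW *)

Section existence.
Variables (R : realType) (n : nat) (x : R).

Lemma measurable_lt (p : R) : measurable [set u : measurableTypeR R | u < p].
Proof.
rewrite (_ : [set u | _] = `]-oo, p[%classic); first exact: measurable_itv.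
by apply/seteqP; split=> u /=; rewrite in_itv.
Qed.

Lemma uniform01_lt (p : R) : 0 <= p <= 1 ->
  uniform_prob (@ltr01 R) [set u | u < p] = p%:E.
Proof.
move=> /andP[p0 p1]; rewrite /uniform_prob integral_uniform_pdf.
have -> : [set u : R | u < p] `&` `[0, 1] = `[0, p[%classic.
  apply/seteqP; split=> u /=; rewrite !in_itv /=.
    by move=> [-> /andP[-> _]].
  move=> /andP[-> up]; split => //=; exact: ltW (lt_le_trans up p1).
rewrite (eq_integral (fun=> 1%E)); last first.
  move=> u; rewrite inE /= in_itv /= => /andP[u0 up].
  by rewrite /uniform_pdf u0 (ltW (lt_le_trans up p1)) subr0 invr1.
rewrite integral_cst// mul1e [LHS]lebesgue_measure_itv /= lte_fin.
case: ltP => [_|p0']; first by rewrite sube0.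
by have -> : p = 0 by apply/eqP; rewrite eq_le p0 p0'.
Qed.

Lemma uniform01_ge (p : R) : 0 <= p <= 1 ->
  uniform_prob (@ltr01 R) [set u | ~~ (u < p)] = (1 - p)%:E.
Proof.
move=> p01; rewrite (_ : [set u | _] = ~` [set u : R | u < p]).
  have mlt := measurable_lt p.
  by rewrite [LHS](@probability_setC _ _ _ (uniform_prob (@ltr01 R)) _ mlt)
     [X in (_ - X)%E](uniform01_lt p01).
by apply/seteqP; split=> u /=; [move=> /negP|move=> h; apply/negP].
Qed.

Definition RW_law d (T : measurableType d) (P : probability T R)
    (W : nat -> T -> R) (k : nat) (a : nat -> R) : Prop :=
  let z := RW_step_sizes n k (x - a k) in
  (P (past W k a `&` [set w | W k.+1 w = (a k + z.1)%R]) =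
    (z.2 / (z.1 + z.2))%R%:E * P (past W k a))%E /\
  (P (past W k a `&` [set w | W k.+1 w = (a k - z.2)%R]) =
    (z.1 / (z.1 + z.2))%R%:E * P (past W k a))%E.

Section extension.
Context d (T : measurableType d) (P : probability T R) (W : nat -> T -> R).
Variable j : nat.
Hypothesis mW : forall k, measurable_fun setT (W k).

Local Notation U := (uniform_prob (@ltr01 R)).
Local Notation T' := (T * measurableTypeR R)%type.
Local Notation z w := (RW_step_sizes n j (x - W j w)).

(** Step [j] is decided by comparing a fresh uniform coordinate with the probability of moving
    towards the target; all other positions depend on the old coordinate only. *)
Definition RW_extend (k : nat) (t : T') : R :=
  if k == j.+1 then
    if t.2 < (z t.1).2 / ((z t.1).1 + (z t.1).2) then W j t.1 + (z t.1).1
    else W j t.1 - (z t.1).2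
  else W k t.1.

Lemma measurable_RW_extend k : (j < n)%N -> measurable_fun setT (RW_extend k).
Proof.
move=> jn; have m1 : measurable_fun setT (fst : T' -> T) by exact: measurable_fst.
have m2 : measurable_fun setT (snd : T' -> measurableTypeR R).
  exact: measurable_snd.
have mWk i : measurable_fun setT (fun t : T' => W i t.1).
  exact: measurableT_comp (mW i) m1.
rewrite /RW_extend; case: eqP => // _.
have [s1 s2] := @measurable_sizes R (n - j.+1).
have mx : measurable_fun setT (fun t : T' => x - W j t.1).
  exact: measurable_funB.
have mz1 : measurable_fun setT (fun t : T' => (z t.1).1).
  under eq_fun do rewrite RW_step_sizesE//.
  exact: (measurableT_comp s1 mx).
have mz2 : measurable_fun setT (fun t : T' => (z t.1).2).
  under eq_fun do rewrite RW_step_sizesE//.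
  exact: (measurableT_comp s2 mx).
have mzV : measurable_fun setT (fun t : T' => ((z t.1).1 + (z t.1).2)^-1).
  under eq_fun do rewrite RW_step_sizesE//.
  exact: (measurableT_comp (@measurable_sizes_sumV R (n - j.+1)) mx).
apply: measurable_fun_ifT.
- by apply: measurable_fun_ltr => //; exact: measurable_funM.
- exact: measurable_funD.
- exact: measurable_funB.
Qed.

Lemma past_extend k a : (k <= j)%N -> past RW_extend k a = past W k a `*` setT.
Proof.
move=> kj; apply/seteqP; split=> [t h|t [h _] i ik] /=.
  split => // i ik; have := h i ik; rewrite /RW_extend ltn_eqF//.
  by rewrite ltnS (leq_trans ik).
by rewrite /RW_extend ltn_eqF ?h// ltnS (leq_trans ik).
Qed.

Variable Q : probability T' R.
Hypothesis QX : forall (A : set T) (B : set (measurableTypeR R)),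
  measurable A -> measurable B -> Q (A `*` B) = (P A * U B)%E.

(** For [k < j] all the events are cylinders over the old space and keep their probabilities; for
    [k = j] they are rectangles whose second side is a threshold event. *)
Lemma RW_law_extend k a : (j < n)%N -> (k <= j)%N -> a k < x ->
  ((k < j)%N -> RW_law P W k a) -> RW_law Q RW_extend k a.
Proof.
move=> jn kj ax law.
have mp : measurable (past W k a).
  rewrite (_ : past W k a =
    \bigcap_(i in [set i | (i <= k)%N]) (W i @^-1` [set a i])).
    apply: bigcap_measurable; first by exists 0%N.
    by move=> i /= ik; rewrite -[_ @^-1` _]setTI; apply: mW.
  by apply/seteqP; split=> w /= h i; exact: h.
rewrite /RW_law past_extend//.
have -> : Q (past W k a `*` setT) = P (past W k a).
  by rewrite QX//
    [X in (_ * X)%E](@probability_setT _ _ _ (uniform_prob (@ltr01 R))) mule1.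
move: kj; rewrite leq_eqVlt => /predU1P[kE|kj].
  subst k; have r0 : 0 < x - a j by rewrite subr_gt0.
  have := sizes_bounds (n - j.+1) r0; rewrite -RW_step_sizesE//.
  case E : (RW_step_sizes n j (x - a j)) => [sl sr] /= [b1 b2 b3].
  have p01 : 0 <= sr / (sl + sr) <= 1.
    by rewrite divr_ge0 /= ?ler_pdivrMr; lra.
  have qE : 1 - sr / (sl + sr) = sl / (sl + sr).
    by field; apply/eqP => ?; lra.
  split.
    rewrite (_ : _ `&` _ = past W j a `*` [set u | u < sr / (sl + sr)]).
      rewrite QX//; last exact: measurable_lt.
      by rewrite uniform01_lt// muleC.
    apply/seteqP; split=> [[w u] /= [[pw _]]|[w u] /= [pw up]];
      have Wj : W j w = a j by exact: pw.
      rewrite /RW_extend eqxx /= Wj E /=; case: ifP => // _ h; exfalso; lra.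
    by rewrite /RW_extend eqxx /= Wj E /= up.
  rewrite (_ : _ `&` _ = past W j a `*` [set u | ~~ (u < sr / (sl + sr))]).
    rewrite QX//.
      by rewrite uniform01_ge// qE muleC.
    rewrite (_ : [set u | _] = ~` [set u | u < sr / (sl + sr)]).
      by apply: measurableC; exact: measurable_lt.
    by apply/seteqP; split=> u /=; [move=> /negP|move=> h; apply/negP].
  apply/seteqP; split=> [[w u] /= [[pw _]]|[w u] /= [pw up]];
    have Wj : W j w = a j by exact: pw.
    by rewrite /RW_extend eqxx /= Wj E /=; case: ifP => // _ h; exfalso; lra.
  by rewrite /RW_extend eqxx /= Wj E /= (negbTE up).
have mE c : measurable [set w | W k.+1 w = c].
  rewrite (_ : [set w | _] = setT `&` W k.+1 @^-1` [set c]) ?setTI//.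
  by rewrite -[X in measurable X]setTI; apply: mW.
have ext c : Q ((past W k a `*` setT) `&`
    [set t | RW_extend k.+1 t = c]) =
    P (past W k a `&` [set w | W k.+1 w = c]).
  rewrite (_ : _ `&` _ = (past W k a `&` [set w | W k.+1 w = c]) `*` setT).
    rewrite QX//; last exact: measurableI.
    by rewrite [X in (_ * X)%E](@probability_setT _ _ _ (uniform_prob (@ltr01 R))) mule1.
  apply/seteqP; split=> t /=; rewrite /RW_extend eqSS ltn_eqF//.
    by move=> [[]].
  by move=> [[]].
by rewrite !ext; exact: law.
Qed.

End extension.

(** Shows that the statement about realizations of RW is not vacuous. The probability space grows by
    one uniform factor per step, so the induction on the number of prescribed steps quantifies over
    the space. *)
Lemma RW_exists : exists (d : measure_display) (T : measurableType d)
  (P : probability T R) (W : nat -> T -> R), is_RW P n x W.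
Proof.
suff : forall j, (j <= n)%N -> exists (d : measure_display)
    (T : measurableType d) (P : probability T R) (W : nat -> T -> R),
    [/\ forall w, W 0%N w = 0, forall k, measurable_fun setT (W k) &
      forall k a, (k < j)%N -> a k < x -> RW_law P W k a].
  move=> /(_ n (leqnn n)) [d [T [P [W [W0 mW law]]]]].
  exists d, T, P, W; split => // k a kn ax; have := law k a kn ax.
  by rewrite /RW_law; case: (RW_step_sizes _ _ _).
elim=> [_|j IH jn].
  exists _, (measurableTypeR R), (uniform_prob (@ltr01 R)), (fun _ _ => 0).
  by split.
have [d [T [P [W [W0 mW law]]]]] := IH (ltnW jn).
exists _, (T * measurableTypeR R)%type, (P \x uniform_prob (@ltr01 R))%E,
  (RW_extend W j).
split.
- by move=> t; rewrite /RW_extend /= W0.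
- by move=> k; exact: measurable_RW_extend.
- move=> k a kj ax; apply: (@RW_law_extend _ _ P) => // [A B mA mB|kj'].
    exact: product_measure1E.
  exact: law.
Qed.

End existence.

Theorem theorem1 (R : realType) (n : nat) (x : R) :
  (exists (d : measure_display) (T : measurableType d) (P : probability T R)
          (W : nat -> T -> R), is_RW P n x W) /\
  (forall (d : measure_display) (T : measurableType d) (P : probability T R)
          (W : nat -> T -> R), is_RW P n x W ->
     [/\ martingale_walk P n (stopped n W x),
         D n x = P (visits n (stopped n W x) x) &
         P (visits n (stopped n W x) x) = P [set w | x <= stopped n W x n w]]).
Proof.
split; first exact: RW_exists.
move=> d T P W RW; split.
- exact: stopped_RW_martingale.
- by rewrite (D_win RW) (prob_visits_stopped_RW RW).
- by rewrite visits_stopped.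
Qed.
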